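(* Let $O$ be a positive definite, self-adjoint, invertible operator on the real Hilbert space $L^2[0,1]$ that decomposes as $O = D(\mathbf{I}+K)D$. Here $\mathbf{I}$ is the identity, and $D$ is the multiplication operator $(Df)(t)=D(t)f(t)$ by a function $D(t)$ that is continuous on $[0,1]$ with $0<D_{\inf}<D(t)<D_{\sup}<\infty$ for all $t\in[0,1]$, for some constants $D_{\inf},D_{\sup}$. $K$ is the integral operator $(Kf)(t)=\int_0^1 K(t,s)f(s)\,\mathrm{d}s$ with positive (i.e. $K(s,t)\ge 0$ for all $s,t$), symmetric and continuous kernel $K:[0,1]^2\to\mathbb{R}$. Let $M_n$ be the finite $n\times n$ matrix approximation of $O$, that is $$(M_n)_{i,j}=\tfrac1n D\!\left(\tfrac{i-1/2}{n}\right)K\!\left(\tfrac{i-1/2}{n},\tfrac{j-1/2}{n}\right)D\!\left(\tfrac{j-1/2}{n}\right)+D\!\left(\tfrac{i-1/2}{n}\right)^2 1_{i=j}.$$ Furthermore, let $(y_n)$ be a bounded sequence of vectors, $y_n\in\mathbb{R}^n$ (i.e. $\sup_n\max_i|(y_n)_i|<\infty$), and let $f_n\in L^2[0,1]$ be the piecewise-constant embedding of $y_n$: $$f_n(t)=(y_n)_i\quad\text{for } t\in\left(\tfrac{i-1}{n},\tfrac in\right),\ i=1,\dots,n.$$ Let $d(K)$ be the Fredholm determinant of $K$ and let $l$ be the functional log-likelihood $$l(f_n,O)=\langle f_n,O^{-1}f_n\rangle+\int_0^1\log D(t)\,\mathrm{d}t+\tfrac1n\log d(K).$$ Then $$\tfrac1n\left(y_n^\top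 M_n^{-1}y_n+\log\det M_n\right)-l(f_n,O)\to 0\quad\text{for } n\to\infty.$$ In detail, the following three convergences hold as $n\to\infty$: $$\tfrac1n y_n^\top M_n^{-1}y_n-\langle f_n,O^{-1}f_n\rangle\to 0,$$ $$\log\det R_n\to\log d(K),$$ $$\tfrac1n\log\det S_n\to\int_0^1\log D(t)\,\mathrm{d}t,$$ where $S_n$ and $R_n$ are given by the decomposition $M_n=S_nR_nS_n$ with $$(R_n)_{i,j}=\tfrac1n K\!\left(\tfrac{i-1/2}{n},\tfrac{j-1/2}{n}\right)+1_{i=j},\qquad (S_n)_{i,j}=D\!\left(\tfrac{i-1/2}{n}\right)1_{i=j}.$$
   Context: $\langle\cdot,\cdot\rangle$ is the inner product of the real Hilbert space $L^2[0,1]$ (Lebesgue measure). The Fredholm determinant of an integral operator $K$ on $L^2[0,1]$ with continuous kernel $K(\cdot,\cdot)$ is $$d(K)=\sum_{k=0}^\infty\frac{1}{k!}\int_0^1\cdots\int_0^1\det\left[K(x_p,x_q)\right]_{p,q=1}^k\,\mathrm{d}x_1\cdots\mathrm{d}x_k,$$ where the $k=0$ term equals $1$.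
   Formalization: In the functional log-likelihood l(f_n,O) the term ∫log D(t)dt is given coefficient 2, since with coefficient 1 the first limit fails (K=0, D=2, y=0 gives log 4 against log 2). *)

(* Defs.v *)
From HB Require Import structures.
From mathcomp Require Import all_boot all_order all_algebra.
From mathcomp Require Import all_classical all_reals all_analysis.
Set Implicit Arguments.
Unset Strict Implicit.
Unset Printing Implicit Defensive.
Import Order.TTheory GRing.Theory Num.Theory.
Import numFieldNormedType.Exports.
Local Open Scope classical_set_scope.
Local Open Scope ring_scope.

Section L2_unit_interval.
Context {R : realType}.

Definition mu01 : {measure set (measurableTypeR R) -> \bar R} :=
  mrestr (@lebesgue_measure R) (measurable_itv `[0%R, 1%R]).

Lemma le1_2E : (1 <= 2%:E :> \bar R)%E.
Proof. by rewrite lee_fin ler1n. Qed.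

(* Representatives of the elements of L^2[0,1]: the library type is not
   quotiented, so every identity between elements of L^2[0,1] below is stated
   mu01-almost everywhere.  Values outside [0,1] are irrelevant. *)
Definition L2 := LfunType mu01 le1_2E.

Definition ip (f g : L2) : R :=
  \int[lebesgue_measure]_(t in `[0%R, 1%R]) (f t * g t).

(* A bounded linear operator on L^2[0,1], given on representatives; the first
   clause says that it is well defined on a.e.-classes. *)
Definition bounded_operator (T : L2 -> L2) : Prop :=
  [/\ forall f g : L2, {ae mu01, forall t, f t = g t} ->
        {ae mu01, forall t, T f t = T g t},
      forall (a : R) (f g : L2),
        {ae mu01, forall t, T (a *: f + g) t = a * T f t + T g t} &
      exists C : R, forall f : L2,
        ('N[mu01]_2%:E[EFin \o T f] <= C%:E * 'N[mu01]_2%:E[EFin \o f])%E].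

Definition self_adjoint (T : L2 -> L2) : Prop :=
  forall f g : L2, ip (T f) g = ip f (T g).

Definition positive_definite (T : L2 -> L2) : Prop :=
  forall f : L2, ~ {ae mu01, forall t, f t = 0} -> 0 < ip f (T f).

(* T is invertible in the algebra of bounded operators, with inverse Tinv. *)
Definition inverse_operator (T Tinv : L2 -> L2) : Prop :=
  [/\ bounded_operator Tinv,
      forall f : L2, {ae mu01, forall t, Tinv (T f) t = f t} &
      forall f : L2, {ae mu01, forall t, T (Tinv f) t = f t}].

End L2_unit_interval.
Arguments L2 R : clear implicits.

Section functional_likelihood.
Context {R : realType}.
Implicit Types (D : R -> R) (K : R -> R -> R).

Definition mult_op D (f : R -> R) : R -> R := fun t => D t * f t.

Definition integral_op K (f : R -> R) : R -> R :=
  fun t => \int[lebesgue_measure]_(s in `[0%R, 1%R]) (K t s * f s).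

(* O = D (I + K) D as operators on L^2[0,1] *)
Definition decomposes (O : L2 R -> L2 R) D K : Prop :=
  forall f : L2 R, {ae mu01, forall t,
    O f t = mult_op D (mult_op D f \+ integral_op K (mult_op D f)) t}.

(* int_0^1 ... int_0^1 F [:: x_1; ...; x_k] dx_k ... dx_1 *)
Fixpoint iter_int01 (k : nat) (F : seq R -> R) : R :=
  if k is k'.+1 then
    \int[lebesgue_measure]_(x in `[0%R, 1%R])
      iter_int01 k' (fun xs => F (x :: xs))
  else F [::].

Definition fredholm_term K (k : nat) : R :=
  (k`!%:R)^-1 *
  iter_int01 k (fun xs => \det (\matrix_(p < k, q < k) K xs`_p xs`_q)).

Definition fredholm_det K : R := limn (series (fredholm_term K)).

(* Ordinals start at 0, so the i-th midpoint (i - 1/2)/n is (i + 1/2)/n. *)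
Definition midpoint (n : nat) (i : 'I_n) : R := (i%:R + 2^-1) / n%:R.

Definition Mmx D K (n : nat) : 'M[R]_n :=
  \matrix_(i, j) (n%:R^-1 * D (midpoint i) * K (midpoint i) (midpoint j)
                    * D (midpoint j)
                  + D (midpoint i) ^+ 2 * (i == j)%:R).

Definition Rmx K (n : nat) : 'M[R]_n :=
  \matrix_(i, j) (n%:R^-1 * K (midpoint i) (midpoint j) + (i == j)%:R).

Definition Smx D (n : nat) : 'M[R]_n :=
  \matrix_(i, j) (D (midpoint i) * (i == j)%:R).

(* The values of f at the grid points i/n are left free. *)
Definition embeds (n : nat) (y : 'cV[R]_n) (f : L2 R) : Prop :=
  forall (i : 'I_n) (t : R),
    i%:R / n%:R < t < i.+1%:R / n%:R -> f t = y i 0.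

Definition quad_inv (n : nat) (M : 'M[R]_n) (y : 'cV[R]_n) : R :=
  (y^T *m invmx M *m y) 0 0.

Definition int_log D : R :=
  \int[lebesgue_measure]_(t in `[0%R, 1%R]) ln (D t).

(* l(f, O) at sample size n, with Oinv the inverse of O = D (I + K) D.
   The term int log D carries the coefficient 2 because the factor D occurs
   twice in O; with coefficient 1, ln (det M_n) / n would not be matched
   (K = 0 and D = 2 give ln 4 against ln 2). *)
Definition loglik (n : nat) D K (Oinv : L2 R -> L2 R) (f : L2 R) : R :=
  ip f (Oinv f) + 2 * int_log D + n%:R^-1 * ln (fredholm_det K).

End functional_likelihood.

(* Main.v *)
(* Write B = A^-1.  Expanding 0 <= <h, A h> at h = B g - C g with C >= |B| gives
   <g, g> <= C <g, A g>.  On step functions, A and M_n agree up to a relative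
   error that tends to 0, so M_n, and hence R_n = 1 + H_n, is coercive uniformly
   in n.  As H_n has entries O(1/n), so has R_n^-1 - 1 = - H_n + H_n R_n^-1 H_n,
   and Hadamard's inequality for R_n^-1 bounds det R_n away from 0; this gives
   d(K) > 0 without spectral theory.  The expansion of det (1 + H_n) in principal
   minors consists of the midpoint sums of the Fredholm terms, and Hadamard's
   inequality for the minors dominates it by a convergent series.  Finally
   u = M_n^-1 y is bounded, its step function g satisfies A g ~ f uniformly, and
   <f, g> - <f, B f> = <B f, A g - f>. *)
Require Import Defs.
From HB Require Import structures.
From mathcomp Require Import all_boot all_order all_algebra.
From mathcomp Require Import all_classical all_reals all_analysis measurable_realfun.
From mathcomp Require Import perm ring lra.
Set Implicit Arguments.
Unset Strict Implicit.
Unset Printing Implicit Defensive.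
Import Order.TTheory GRing.Theory Num.Theory.
Import numFieldNormedType.Exports.
Local Open Scope ring_scope.

(** * Determinants and principal minors *)

(** Neither the [f_n] nor the [y_n] need converge, so the quadratic part has no limit object: its
    estimates are uniform over all vectors with a given bound. Coercivity controls [M_n^-1 y] in
    quadratic mean, while the final comparison of [A g] with [f] is uniform and uses a bound on each
    entry. The estimate [R_n^-1 - 1 = O(1/n)], entry by entry, serves both ends. It bounds [R_n^-1]
    in the sup norm, uniformly in [n]; and it makes the squared norm of each row of [R_n^-1] equal
    to [1 + O(1/n)], so that the product of [n] such norms in Hadamard's inequality stays bounded.
    It follows from coercivity because rows and columns of [H_n] have Euclidean norm [O(n^(-1/2))],
    and one of each surrounds [R_n^-1] in [H_n R_n^-1 H_n]. On the Fredholm side the multiple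
    integrals are iterated one-variable integrals of functions of lists, so their midpoint sums are
    handled one variable at a time with moduli of continuity, not with product measures. *)

Section posdef.
Variable R : realFieldType.

Definition qform n (A : 'M[R]_n) (x : 'cV[R]_n) : R := (x^T *m A *m x) 0 0.

Definition posdef n (A : 'M[R]_n) :=
  A^T = A /\ forall x : 'cV[R]_n, x != 0 -> 0 < qform A x.

Lemma qform_delta n (A : 'M[R]_n) i : qform A (delta_mx i 0) = A i i.
Proof. by rewrite /qform trmx_delta -rowE -colE !mxE. Qed.

Lemma posdef_diag n (A : 'M[R]_n) i : posdef A -> 0 < A i i.
Proof.
case=> _ /(_ (delta_mx i 0)); rewrite qform_delta; apply.
by apply/eqP => /matrixP/(_ i 0)/eqP; rewrite !mxE !eqxx oner_eq0.
Qed.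

(** Schur complement induction. With [a] the first diagonal entry, [S = C - a^-1 b b^T] is positive
    definite and [det A = a det S]; its diagonal entries [C_ii - b_i^2 / a] do not exceed those of
    [C]. *)
Lemma posdef_det n (A : 'M[R]_n) : posdef A -> 0 < \det A <= \prod_i A i i.
Proof.
elim: n A => [|n IH] A pA; first by rewrite det_mx00 big_ord0 ltr01 lexx.
have a0 := posdef_diag ord0 pA; case: pA => Asym Apos.
pose B : 'M[R]_(1 + n) := A.
pose a := A 0 0; pose b := dlsubmx B; pose C := drsubmx B.
have Bul : ulsubmx B = a%:M.
  by rewrite [LHS]mx11_scalar; congr (_%:M); rewrite !mxE; congr (A _ _); apply/val_inj.
have Bur : ursubmx B = b^T by rewrite /b trmx_dlsub Asym.
have CT : C^T = C by rewrite /C trmx_drsub Asym.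
have AE : B = block_mx a%:M b^T b C by rewrite -Bul -Bur submxK.
have {}a0 : 0 < a by [].
have a'0 : a != 0 by rewrite gt_eqF.
pose S := C - a^-1 *: (b *m b^T).
have LA : block_mx 1%:M 0 (- (a^-1 *: b)) 1%:M *m B = block_mx a%:M b^T 0 S.
  rewrite AE mulmx_block !mul1mx !mul0mx !addr0; congr block_mx.
    by rewrite mulNmx mul_mx_scalar scalerA mulfV// scale1r addNr.
  by rewrite mulNmx -scalemxAl addrC.
have detA : \det A = a * \det S.
  have := congr1 determinant LA.
  by rewrite det_mulmx det_lblock !det1 !mul1r det_ublock det_scalar1.
have pS : posdef S.
  split.
    by rewrite /S linearB /= CT linearZ /= trmx_mul trmxK.
  move=> y y0.
  (* For given [y] this first coordinate kills the first component of [A *m x], so the form of [A]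
     at [x] is that of [S] at [y]. *)
  pose x : 'cV[R]_(1 + n) := col_mx (- (a^-1 *: (b^T *m y))) y.
  have x0 : x != 0.
    apply: contra_neq y0 => /(congr1 dsubmx).
    by rewrite /x col_mxKd linear0.
  have := Apos x x0; rewrite /qform; congr (_ < _).
  have -> : A = block_mx a%:M b^T b C by rewrite -AE.
  rewrite -!mulmxA.
  have -> : block_mx a%:M b^T b C *m x = col_mx 0 (S *m y).
    rewrite /x mul_block_col; congr col_mx.
      by rewrite mul_scalar_mx scalerN scalerA mulfV// scale1r addNr.
    by rewrite /S mulmxBl mulmxN -scalemxAr -scalemxAl mulmxA addrC.
  have -> : x^T *m col_mx 0 (S *m y) = y^T *m (S *m y); last by [].
  rewrite -[RHS]add0r -[X in X + _](mulmx0 _ (- (a^-1 *: (b^T *m y)))^T).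
  by rewrite -mul_row_col -tr_col_mx.
have /andP[dS leS] := IH S pS.
rewrite detA mulr_gt0 //= big_ord_recl; apply: ler_pM => //; first exact: ltW.
  exact: ltW.
apply: le_trans leS _; apply: ler_prod => i _.
rewrite ltW ?(posdef_diag i pS)//= /S !mxE big_ord1 !mxE.
have -> : rshift 1 i = lift ord0 i by apply/val_inj.
rewrite gerBl mulr_ge0 ?invr_ge0 ?(ltW a0)//.
by rewrite -expr2 sqr_ge0.
Qed.

Lemma qform_gram n (A : 'M[R]_n) x :
  qform (A *m A^T) x = \sum_i ((A^T *m x) i 0) ^+ 2.
Proof.
rewrite /qform mulmxA -mulmxA.
have -> : x^T *m A = (A^T *m x)^T by rewrite trmx_mul trmxK.
by rewrite mxE; apply: eq_bigr => i _; rewrite mxE expr2.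
Qed.

Lemma sumsq_gt0 n (x : 'cV[R]_n) : x != 0 -> 0 < \sum_i (x i 0) ^+ 2.
Proof.
move=> x0; rewrite lt_neqAle eq_sym sumr_ge0 ?andbT; last first.
  by move=> i _; rewrite sqr_ge0.
apply: contra x0; rewrite psumr_eq0 => [/allP h|i _]; last by rewrite sqr_ge0.
apply/eqP/colP => i; rewrite !mxE; apply/eqP.
by move: (h i (mem_index_enum _)); rewrite sqrf_eq0.
Qed.

(** The Gram matrix [A A^T] has determinant [det A ^ 2] and the squared row norms on its diagonal.
    The squared form avoids square roots in a real field. *)
Lemma hadamard n (A : 'M[R]_n) :
  \det A ^+ 2 <= \prod_i \sum_j (A i j) ^+ 2.
Proof.
have [d0|d0] := eqVneq (\det A) 0.
  rewrite d0 expr0n /= prodr_ge0 // => i _.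
  by apply: sumr_ge0 => j _; rewrite sqr_ge0.
have pA : posdef (A *m A^T).
  split; first by rewrite trmx_mul trmxK.
  move=> x x0; rewrite qform_gram; apply: sumsq_gt0.
  apply: contraNneq x0 => Ax.
  have uA : A^T \in unitmx by rewrite unitmx_tr unitmxE unitfE.
  by rewrite -(mulKmx uA x) Ax mulmx0.
have /andP[_] := posdef_det pA.
rewrite det_mulmx det_tr -expr2 => /le_trans; apply.
apply: ler_prod => i _; rewrite ltW ?(posdef_diag i pA)//= mxE.
by apply: ler_sum => j _; rewrite mxE expr2.
Qed.

End posdef.

(** * Expansion of det (1 + H) in principal minors *)

Section principal_minors.
Variable R : comRingType.

(** The block matrix [X] multiplied by one and the same unipotent matrix, on the right and on the
    left, gives two block triangular matrices. No entry or block has to be invertible. *)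
Lemma sylvester_det m n (A : 'M[R]_(m, n)) (B : 'M[R]_(n, m)) :
  \det (1%:M + A *m B) = \det (1%:M + B *m A).
Proof.
pose X := block_mx 1%:M (- A) B 1%:M.
have E1 : X *m block_mx 1%:M A 0 1%:M = block_mx 1%:M 0 B (1%:M + B *m A).
  by rewrite mulmx_block !mul1mx !mulmx1 !mulmx0 !addr0 subrr [_ + 1%:M]addrC.
have E2 : block_mx 1%:M A 0 1%:M *m X = block_mx (1%:M + A *m B) 0 B 1%:M.
  by rewrite mulmx_block !mul1mx !mulmx1 !mul0mx !add0r addNr.
move/(congr1 determinant): E1; move/(congr1 determinant): E2.
rewrite !det_mulmx det_ublock !det_lblock !det1 !mul1r !mulr1.
by move=> <- <-.
Qed.

(** Its determinant is the principal minor of [H] on [S]; keeping the size [n] avoids enumerating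
    [S]. *)
Definition mixed_rows n (H : 'M[R]_n) (S : {set 'I_n}) : 'M[R]_n :=
  \matrix_(i, j) if i \in S then H i j else (i == j)%:R.

(** Multilinearity in the rows, carried out inside the Leibniz formula: for a fixed permutation
    every factor is a sum of two terms, and a choice of terms is a subset. *)
Lemma det_add1_subsets n (H : 'M[R]_n) :
  \det (1%:M + H) = \sum_(S : {set 'I_n}) \det (mixed_rows H S).
Proof.
rewrite /determinant exchange_big /=; apply: eq_bigr => s _.
rewrite -mulr_sumr; congr (_ * _).
transitivity (\prod_i \sum_(b : bool)
   (if b then H i (s i) else (i == s i)%:R)).
  by apply: eq_bigr => i _; rewrite big_bool !mxE addrC.
rewrite bigA_distr_bigA /=.
rewrite (reindex (fun S : {set 'I_n} => [ffun i => i \in S])) /=; last first.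
  exists (fun f : {ffun 'I_n -> bool} => [set i | f i]) => [S _|f _].
    by apply/setP => i; rewrite inE ffunE.
  by apply/ffunP => i; rewrite ffunE inE.
apply: eq_bigr => S _; apply: eq_bigr => i _.
by rewrite ffunE mxE.
Qed.

(* If E is the 0/1 matrix that selects the rows of t, then E E^T = 1 and the
   mixed matrix is 1 + E^T (E H - E), so Sylvester's identity applies. *)
Lemma det_minor_uniq n (H : 'M[R]_n) k (t : k.-tuple 'I_n) : uniq t ->
  \det (\matrix_(p < k, q < k) H (tnth t p) (tnth t q)) =
  \det (mixed_rows H [set i in t]).
Proof.
move=> ut.
have tI : injective (tnth t) by apply/tuple_uniqP.
pose E : 'M[R]_(k, n) := \matrix_(p, j) (tnth t p == j)%:R.
have EM (m : nat) (X : 'M[R]_(n, m)) p j : (E *m X) p j = X (tnth t p) j.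
  rewrite mxE (bigD1 (tnth t p)) //= big1 ?addr0 => [|i it].
    by rewrite mxE eqxx mul1r.
  by rewrite mxE eq_sym (negbTE it) mul0r.
have EE : E *m E^T = 1%:M.
  apply/matrixP => p q; rewrite EM !mxE eq_sym.
  by rewrite (inj_eq tI).
have EME : E *m H *m E^T = \matrix_(p < k, q < k) H (tnth t p) (tnth t q).
  apply/matrixP => p q; rewrite -mulmxA EM !mxE.
  rewrite (bigD1 (tnth t q)) //= big1 ?addr0 => [|i it].
    by rewrite !mxE eqxx mulr1.
  by rewrite !mxE eq_sym (negbTE it) mulr0.
have -> : mixed_rows H [set i in t] = 1%:M + E^T *m (E *m H - E).
  apply/matrixP => i j; rewrite !mxE inE.
  case: ifPn => [/tnthP [p ->]|it].
    rewrite (bigD1 p) //= big1 ?addr0 => [|q qp].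
      have := EM _ H p j; rewrite !mxE eqxx mul1r => ->.
      by rewrite addrC subrK.
    by rewrite !mxE (inj_eq tI) (negbTE qp) mul0r.
  rewrite big1 ?addr0 // => p _; rewrite !mxE.
  case: eqP => [pi|_]; last by rewrite mul0r.
  by move: it; rewrite -pi mem_tnth.
rewrite sylvester_det mulmxBl EE EME; congr determinant.
by rewrite addrC subrK.
Qed.

Lemma det_minor_nuniq n (H : 'M[R]_n) k (t : k.-tuple 'I_n) : ~~ uniq t ->
  \det (\matrix_(p < k, q < k) H (tnth t p) (tnth t q)) = 0.
Proof.
move=> /negP nt.
have /injectivePn [p [q pq tpq]] : ~~ injectiveb (tnth t).
  by apply/negP => /injectiveP /tuple_uniqP.
by apply: (determinant_alternate pq) => j; rewrite !mxE tpq.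
Qed.

(** A tuple with a repetition has minor zero, and a set of [k] indices is enumerated by exactly [k!]
    duplicate-free tuples. Sums over all tuples are what midpoint sums of the Fredholm terms
    produce. *)
Lemma sum_minors_card n (H : 'M[R]_n) k :
  \sum_(t : k.-tuple 'I_n)
     \det (\matrix_(p < k, q < k) H (tnth t p) (tnth t q)) =
  (\sum_(S : {set 'I_n} | #|S| == k) \det (mixed_rows H S)) *+ k`!.
Proof.
rewrite (bigID (fun t : k.-tuple 'I_n => uniq t)) /= [X in _ + X]big1 ?addr0;
  last by move=> t; exact: det_minor_nuniq.
rewrite (eq_bigr _ (fun t => @det_minor_uniq n H k t)).
rewrite (partition_big (fun t : k.-tuple 'I_n => [set i in t])
   (fun S => #|S| == k)) /=; last first.
  by move=> t ut; rewrite cardsE (card_uniqP ut) size_tuple.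
rewrite -sumrMnl; apply: eq_bigr => S /eqP Sk.
rewrite (eq_bigr (fun _ => \det (mixed_rows H S))); last first.
  by move=> t /andP[_ /eqP ->].
rewrite sumr_const; congr (_ *+ _).
rewrite -[in RHS]Sk -ffactnn {2}Sk -card_uniq_tuples.
apply: eq_card => t; rewrite !inE.
rewrite !unfold_in andbC; apply/andb_id2r => ut.
apply/eqP/allP => [<- i it|tS].
  by have : i \in [set j in t] by rewrite inE.
apply/eqP; rewrite eqEcard; apply/andP; split.
  by apply/fintype.subsetP => i; rewrite inE => /tS.
by rewrite Sk cardsE (card_uniqP ut) size_tuple.
Qed.

End principal_minors.

(** Terms with [k > n] vanish, so the cut-off [N] is left free: the partial sums are eventually
    constant, which is how the expansion enters the limit of series. *)
Lemma det_add1_minors (R : numFieldType) n (H : 'M[R]_n) N : (n < N)%N ->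
  \det (1%:M + H) = \sum_(0 <= k < N) (k`!%:R)^-1 *
    \sum_(t : k.-tuple 'I_n)
       \det (\matrix_(p < k, q < k) H (tnth t p) (tnth t q)).
Proof.
move=> nN; rewrite det_add1_subsets big_mkord.
(* [inord] truncates nothing here, since [#|S| <= n < N]. *)
rewrite (partition_big (fun S : {set 'I_n} => inord #|S| : 'I_N.-1.+1) xpredT) //=.
have N0 : N.-1.+1 = N by rewrite prednK // (leq_ltn_trans _ nN).
move: nN; rewrite -[in X in X -> _]N0 -[in RHS]N0 => nN.
apply: eq_bigr => k _; rewrite sum_minors_card -[X in _^-1 * X]mulr_natl mulKf.
  apply: eq_bigl => S; rewrite -val_eqE /= inordK //.
  by rewrite (leq_ltn_trans (max_card _)) // card_ord.
by rewrite pnatr_eq0 -lt0n fact_gt0.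
Qed.

(** * Inverse of a coercive matrix 1 + H with entries of H of order 1/n *)

Section resolvent.
Variables (R : realFieldType) (n : nat) (H : 'M[R]_n) (M c : R).
Hypotheses (c_gt0 : 0 < c) (H_sym : H^T = H).
Hypothesis H_le : forall i j, `|H i j| <= M / n%:R.
Hypothesis H_coercive :
  forall v : 'cV[R]_n, c * \sum_i v i 0 ^+ 2 <= qform (1%:M + H) v.

(** Up to the factor [1/n], [M] bounds the entries of [- H], and [M^2 / c] those of [H R^-1 H],
    where [R = 1 + H]. *)
Let Q := M + M ^+ 2 / c.

Lemma posdef_add1 : posdef (1%:M + H).
Proof.
split; first by rewrite linearD /= trmx1 H_sym.
by move=> v v0; apply: lt_le_trans (H_coercive v); rewrite mulr_gt0 // sumsq_gt0.
Qed.

Lemma add1_unitmx : 1%:M + H \in unitmx.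
Proof.
rewrite unitmxE unitfE gt_eqF //.
by case/andP: (posdef_det posdef_add1).
Qed.

(** Young's inequality; the weight [c] is the coercivity constant, so that half of [c |b|^2] can be
    absorbed by the quadratic form. *)
Let dot_le (a b : 'I_n -> R) :
  `|\sum_k a k * b k| <= (\sum_k a k ^+ 2 / c + c * \sum_k b k ^+ 2) / 2.
Proof.
rewrite mulr_sumr -big_split /= mulr_suml.
apply: le_trans (ler_norm_sum _ _ _) _; apply: ler_sum => k _.
have c0 : c != 0 by rewrite gt_eqF.
have hp : 0 <= (a k - c * b k) ^+ 2 / c by rewrite mulr_ge0 ?sqr_ge0 ?invr_ge0 ?ltW.
have hm : 0 <= (a k + c * b k) ^+ 2 / c by rewrite mulr_ge0 ?sqr_ge0 ?invr_ge0 ?ltW.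
have ep : (a k - c * b k) ^+ 2 / c = a k ^+ 2 / c + c * b k ^+ 2 - 2 * (a k * b k) by field.
have em : (a k + c * b k) ^+ 2 / c = a k ^+ 2 / c + c * b k ^+ 2 + 2 * (a k * b k) by field.
rewrite ler_norml; move: hp hm; rewrite ep em => hp hm.
by apply/andP; split; lra.
Qed.

Let row_le (i : 'I_n) : \sum_k H i k ^+ 2 / c <= M ^+ 2 / c / n%:R.
Proof.
have n0 : n%:R != 0 :> R by rewrite pnatr_eq0 -lt0n (leq_ltn_trans _ (ltn_ord i)).
have -> : M ^+ 2 / c / n%:R = \sum_(k < n) (M / n%:R) ^+ 2 / c.
  rewrite sumr_const card_ord -mulr_natr.
  by have := gt_eqF c_gt0 => /negbT c0; field; rewrite n0 c0.
apply: ler_sum => k _; rewrite ler_pM2r ?invr_gt0 //.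
by rewrite -[X in X <= _]real_normK ?num_real // lerXn2r ?nnegrE // (le_trans _ (H_le i k)).
Qed.

(** A row of [H] has squared norm [O(1/n)], and by coercivity so has the image of a column of [H]
    under the inverse; their product is therefore [O(1/n)]. *)
Lemma resolvent_entry_le i j : `|(invmx (1%:M + H) - 1%:M) i j| <= Q / n%:R.
Proof.
pose X := invmx (1%:M + H).
have XH : X = 1%:M - X *m H.
  by rewrite -(mulVmx add1_unitmx) mulmxDr mulmx1 addrK.
have HX : X = 1%:M - H *m X.
  by rewrite -(mulmxV add1_unitmx) mulmxDl mul1mx addrK.
have -> : invmx (1%:M + H) - 1%:M = - H + H *m (X *m H).
  rewrite -/X {1}HX addrAC subrr add0r {1}XH mulmxBr mulmx1 opprB addrC //.
(* [v] solves [(1 + H) v = h_j], with [h_j] the column [j] of [H]. Hence [c |v|^2 <= <h_j, v>], and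
   the weighted inequality turns this into [c |v|^2 <= |h_j|^2 / c]. *)
pose v := col j (X *m H).
have vE : (1%:M + H) *m v = col j H.
  by rewrite /v !colE !mulmxA mulmxV ?add1_unitmx // mul1mx.
have sv : c * \sum_k v k 0 ^+ 2 <= M ^+ 2 / c / n%:R.
  have h1 := H_coercive v.
  have h2 : qform (1%:M + H) v = \sum_k H j k * v k 0.
    rewrite /qform -mulmxA vE mxE; apply: eq_bigr => k _.
    by rewrite [v^T 0 k]mxE [col j H k 0]mxE -{1}H_sym [H^T k j]mxE mulrC.
  have h3 := dot_le (H j) (fun k => v k 0).
  have h4 := row_le j.
  have h5 := le_trans (ler_norm _) h3.
  move: h1; rewrite h2 => h1.
  have := le_trans h1 h5; lra.
have e : (H *m (X *m H)) i j = \sum_k H i k * v k 0.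
  by rewrite mxE; apply: eq_bigr => k _; rewrite [v k 0]mxE.
rewrite mxE [(- H) i j]mxE e /Q mulrDl.
apply: le_trans (ler_normD _ _) _; rewrite normrN.
apply: lerD; first exact: H_le.
apply: le_trans (dot_le _ _) _.
by have := row_le i; lra.
Qed.

(** With [L = X - 1], row [i] of the inverse [X] has squared norm [1 + 2 L_ii + sum_j L_ij^2], at
    most [1 + 2 Q / n + n (Q / n)^2]. *)
Lemma det_add1_lower :
  1 <= \det (1%:M + H) ^+ 2 * (1 + (2 * Q + Q ^+ 2) / n%:R) ^+ n.
Proof.
pose X := invmx (1%:M + H).
have d0 : \det (1%:M + H) != 0 by rewrite -unitfE -unitmxE add1_unitmx.
have dX : \det X * \det (1%:M + H) = 1.
  by rewrite -det_mulmx mulVmx ?add1_unitmx // det1.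
have e1 : \det (1%:M + H) ^+ 2 * \det X ^+ 2 = 1.
  by rewrite -exprMn mulrC dX expr1n.
rewrite -[X in X <= _]e1 ler_pM2l ?exprn_even_gt0 //.
apply: le_trans (hadamard X) _.
rewrite -[X in _ <= _ ^+ X]card_ord -prodr_const.
apply: ler_prod => i _; rewrite sumr_ge0 /=; last by move=> ? _; rewrite sqr_ge0.
have n0 : n%:R != 0 :> R by rewrite pnatr_eq0 -lt0n (leq_ltn_trans _ (ltn_ord i)).
pose L := X - 1%:M.
have XE j : X i j = (i == j)%:R + L i j by rewrite /L !mxE [RHS]addrC subrK.
have LQ j : `|L i j| <= Q / n%:R by exact: resolvent_entry_le.
have -> : \sum_j X i j ^+ 2 = 1 + 2 * L i i + \sum_j L i j ^+ 2.
  rewrite (eq_bigr (fun j => ((i == j)%:R * (1 + 2 * L i j)) + L i j ^+ 2)).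
    rewrite big_split /=; congr (_ + _).
    rewrite (bigD1 i) //= eqxx mul1r big1 ?addr0 // => j ji.
    by rewrite eq_sym (negbTE ji) mul0r.
  by move=> j _; rewrite XE; case: eqP => _ /=; ring.
rewrite -addrA lerD2l [leRHS]mulrDl; apply: lerD.
  by rewrite -mulrA ler_pM2l ?ltr0n //; apply: le_trans (ler_norm _) (LQ i).
have -> : Q ^+ 2 / n%:R = \sum_(k < n) (Q / n%:R) ^+ 2.
  by rewrite sumr_const card_ord -mulr_natr; field.
apply: ler_sum => k _.
by rewrite -[X in X <= _]real_normK ?num_real // lerXn2r ?nnegrE // (le_trans _ (LQ k)).
Qed.

End resolvent.

Lemma det_le_entries (R : realFieldType) k (A : 'M[R]_k) M :
  (forall i j, `|A i j| <= M) -> \det A ^+ 2 <= (k%:R * M ^+ 2) ^+ k.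
Proof.
move=> AM; apply: le_trans (hadamard A) _.
rewrite -[X in _ <= _ ^+ X]card_ord -prodr_const.
apply: ler_prod => i _; rewrite sumr_ge0 /=; last by move=> ? _; rewrite sqr_ge0.
have -> : k%:R * M ^+ 2 = \sum_(j < k) M ^+ 2 by rewrite sumr_const card_ord mulr_natl.
apply: ler_sum => j _.
by rewrite -[X in X <= _]real_normK ?num_real // lerXn2r ?nnegrE // (le_trans _ (AM i j)).
Qed.

Local Open Scope classical_set_scope.
Local Open Scope ring_scope.

(** * Midpoint sums and iterated integrals *)

Section unit_interval_integral.
Context {R : realType}.
Notation leb := (@lebesgue_measure R).
Notation I01 := [set` `[0%R : R, 1%R]].

Definition intg01 (f : R -> R) := leb.-integrable I01 (EFin \o f).

#[global] Instance ae_lebesgue_filter : Filter (almost_everywhere leb).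
Proof. exact: ae_filter_ringOfSetsType. Qed.

Lemma intg01D f g : intg01 f -> intg01 g -> intg01 (fun t => f t + g t).
Proof.
move=> hf hg; have : leb.-integrable I01 ((EFin \o f) \+ (EFin \o g))%E.
  by apply: integrableD => //; exact: measurable_itv.
exact.
Qed.

Lemma intg01Z a f : intg01 f -> intg01 (fun t => a * f t).
Proof.
move=> hf; have : leb.-integrable I01 (fun t => a%:E * (EFin \o f) t)%E.
  by apply: integrableZl => //; exact: measurable_itv.
exact.
Qed.

Lemma intg01B f g : intg01 f -> intg01 g -> intg01 (fun t => f t - g t).
Proof.
move=> hf hg; have : leb.-integrable I01 ((EFin \o f) \- (EFin \o g))%E.
  by apply: integrableB => //; exact: measurable_itv.
exact.
Qed.

Lemma intg01_bounded (f : R -> R) M : measurable_fun I01 f ->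
  (forall t, I01 t -> `|f t| <= M) -> intg01 f.
Proof.
move=> mf fM; apply: measurable_bounded_integrable => //.
  by rewrite /= lebesgue_measure_itv /= lte_fin ltr01 ltry.
exists M; split; first exact: num_real.
by move=> y My t tI; apply: le_trans (fM t tI) (ltW My).
Qed.

Lemma Rintegral01_ae_eq (f g : R -> R) : intg01 f -> measurable_fun I01 g ->
  {ae leb, forall t, I01 t -> f t = g t} ->
  intg01 g /\ \int[leb]_(t in I01) f t = \int[leb]_(t in I01) g t.
Proof.
move=> hf mg fg.
have mf := measurable_int _ hf.
have mg' := (measurable_EFinP _ _).2 mg.
have fg' : ae_eq leb I01 (EFin \o f) (EFin \o g).
  by apply: filterS fg => t h tI /=; rewrite h.
split; last by rewrite /Rintegral; congr fine; exact: ae_eq_integral.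
have mI : measurable (I01 : set (measurableTypeR R)) by exact: measurable_itv.
have /integrableP[_ intf] := hf.
apply/integrableP; split => //; apply: le_lt_trans intf.
rewrite le_eqVlt; apply/orP; left; apply/eqP.
apply: ge0_ae_eq_integral => //.
- exact: measurableT_comp.
- exact: measurableT_comp.
- by apply: filterS fg => t h tI; rewrite /= h.
Qed.

(** The difference [g - f] equals its absolute value almost everywhere, and the integral of the
    latter is nonnegative by a pointwise argument. *)
Lemma Rintegral01_ae_le (f g : R -> R) : intg01 f -> intg01 g ->
  {ae leb, forall t, I01 t -> f t <= g t} ->
  \int[leb]_(t in I01) f t <= \int[leb]_(t in I01) g t.
Proof.
move=> hf hg fg; rewrite -subr_ge0 -RintegralB //.
pose h t := g t - f t.
have hh : intg01 h by exact: intg01B.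
have mh : measurable_fun I01 (fun t => `|h t|).
  by apply: measurableT_comp => //; apply/measurable_EFinP; exact: (measurable_int _ hh).
have [|_ ->] := Rintegral01_ae_eq hh mh.
  by apply: filterS fg => t h1 tI; rewrite ger0_norm // subr_ge0 h1.
by apply: Rintegral_ge0 => t _.
Qed.

(** Open intervals, because the embedding of a vector leaves the values at the grid points free;
    cells cover [[0,1]] up to a null set. *)
Definition cell n (i : 'I_n) : set R := `](i%:R / n%:R), (i.+1%:R / n%:R)[.

Definition step n (c : 'I_n -> R) (t : R) : R := \sum_(i < n) c i * \1_(cell i) t.

Lemma cell_disjoint n (i j : 'I_n) t : cell i t -> cell j t -> i = j.
Proof.
rewrite /cell /= !in_itv /= => /andP[i1 i2] /andP[j1 j2]; apply/val_inj/eqP.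
have n0 : 0 < n%:R^-1 :> R by rewrite invr_gt0 ltr0n (leq_ltn_trans _ (ltn_ord i)).
have := lt_trans i1 j2; have := lt_trans j1 i2.
by rewrite !ltr_pM2r // !ltr_nat !ltnS eqn_leq => -> ->.
Qed.

Lemma step_cell n (c : 'I_n -> R) i t : cell i t -> step c t = c i.
Proof.
move=> it; rewrite /step (bigD1 i) //= big1 => [|j ji].
  by rewrite indicE mem_set // mulr1 addr0.
rewrite indicE memNset ?mulr0 // => jt; move/eqP: ji; apply.
exact: cell_disjoint jt it.
Qed.

Lemma cell_sub n (i : 'I_n) : cell i `<=` I01.
Proof.
have n0 : 0 < n%:R :> R by rewrite ltr0n (leq_ltn_trans _ (ltn_ord i)).
move=> t; rewrite /cell /= !in_itv /= => /andP[i1 i2]; apply/andP; split.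
  by apply/ltW/(le_lt_trans _ i1); rewrite divr_ge0.
apply/ltW/(lt_le_trans i2); rewrite ler_pdivrMr // mul1r ler_nat.
exact: ltn_ord.
Qed.

Lemma cell_midpoint n (i : 'I_n) t : cell i t -> `|t - midpoint i| < n%:R^-1.
Proof.
have n0 : 0 < n%:R :> R by rewrite ltr0n (leq_ltn_trans _ (ltn_ord i)).
rewrite /cell /midpoint /= in_itv /= -addn1 natrD => /andP[i1 i2].
have hn : 0 < n%:R^-1 :> R by rewrite invr_gt0.
move: i1 i2; rewrite !mulrDl mul1r ltr_norml => i1 i2.
by apply/andP; split; lra.
Qed.

Lemma midpoint_in n (i : 'I_n) : cell i (midpoint i : R).
Proof.
have n0 : 0 < n%:R :> R by rewrite ltr0n (leq_ltn_trans _ (ltn_ord i)).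
rewrite /cell /midpoint /= in_itv /= !ltr_pM2r ?invr_gt0 // -[i.+1]addn1 natrD.
by apply/andP; split; lra.
Qed.

Lemma midpoint01 n (i : 'I_n) : 0 <= (midpoint i : R) <= 1.
Proof. by have /cell_sub := midpoint_in i; rewrite /= in_itv. Qed.

Lemma measurable_step n (c : 'I_n -> R) D : measurable_fun D (step c).
Proof.
rewrite /step; apply: measurable_sum => i; apply: measurable_funM => //.
by apply: measurable_indic; exact: measurable_itv.
Qed.

Lemma step_le n (c : 'I_n -> R) C t : (forall i, `|c i| <= C) -> 0 <= C ->
  `|step c t| <= C.
Proof.
move=> cC C0; have [[i it]|nt] := pselect (exists i : 'I_n, cell i t).
  by rewrite (step_cell _ it).
rewrite /step big1 ?normr0 // => i _.
by rewrite indicE memNset ?mulr0 // => it; apply: nt; exists i.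
Qed.

Lemma intg01_step n (c : 'I_n -> R) : intg01 (step c).
Proof.
apply: (@intg01_bounded _ (\sum_i `|c i|)) => [|t _]; first exact: measurable_step.
apply: step_le => [i|]; last exact: sumr_ge0.
by rewrite (bigD1 i) //= lerDl sumr_ge0.
Qed.

Lemma Rintegral01_step n (c : 'I_n -> R) :
  \int[leb]_(t in I01) step c t = n%:R^-1 * \sum_i c i.
Proof.
rewrite /Rintegral /step.
under eq_integral do rewrite -sumEFin.
rewrite (@integral_sum _ _ _ leb I01 _ _ (fun i t => (c i * \1_(cell i) t)%:E)) //.
  have e (i : 'I_n) : (\int[leb]_(t in I01) (c i * \1_(cell i) t)%:E = (n%:R^-1 * c i)%:E)%E.
    have n0 : 0 < n%:R :> R by rewrite ltr0n (leq_ltn_trans _ (ltn_ord i)).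
    under eq_integral do rewrite EFinM.
    rewrite integralZl //; last first.
      have /= h := @intg01_step n (fun j => (j == i)%:R).
      apply: eq_integrable h => // t _; rewrite /= /step.
      rewrite (bigD1 i) //= eqxx mul1r big1 ?addr0 // => j ji.
      by rewrite (negbTE ji) mul0r.
    rewrite integral_indic // ?setIidl; last 2 first.
      exact: cell_sub.
      exact: measurable_itv.
    rewrite /cell /= lebesgue_measure_itv /= lte_fin ltr_pM2r ?invr_gt0 // ltr_nat ltnS leqnn.
    rewrite -EFinB -EFinM mulrC; congr EFin; congr (_ * _).
    by rewrite -mulrBl -addn1 natrD addrAC subrr add0r mul1r.
  rewrite (eq_bigr _ (fun i _ => e i)) sumEFin /= mulr_sumr //.
move=> i.
have /= h := @intg01_step n (fun j => if j == i then c i else 0).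
apply: eq_integrable h => // t _; rewrite /= /step.
rewrite (bigD1 i) //= eqxx big1 ?addr0 // => j ji.
by rewrite (negbTE ji) mul0r.
Qed.

(** The points missed are multiples of [1/n], a countable set. Off the grid, truncating [t * n]
    gives the index, and the left inequality is strict. *)
Lemma cells_cover n : (0 < n)%N ->
  {ae leb, forall t, I01 t -> exists i : 'I_n, cell i t}.
Proof.
move=> n0; pose G : set R := range (fun i : nat => i%:R / n%:R).
have cG : countable G by apply: sub_countable (card_image_le _ _) _.
exists G; split.
- exact: countable_measurable.
- exact: countable_lebesgue_measure0.
- move=> t /= nt; apply: contrapT => tG; apply: nt.
  rewrite /= in_itv /= => /andP[t0 t1].
  have n0' : 0 < n%:R :> R by rewrite ltr0n.
  have /andP[k1 k2] := truncn_itv (mulr_ge0 t0 (ltW n0')).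
  set k := Num.trunc _ in k1 k2.
  have k1' : k%:R < t * n%:R.
    rewrite lt_neqAle k1 andbT; apply/eqP => kt; apply: tG; exists k => //.
    by rewrite kt mulfK // gt_eqF.
  have kn : (k < n)%N.
    rewrite -(ltr_nat R); apply: lt_le_trans k1' _.
    by rewrite ler_piMl // ltW.
  exists (Ordinal kn); rewrite /cell /= in_itv /=.
  by rewrite ltr_pdivrMr // k1' ltr_pdivlMr.
Qed.

Lemma Rintegral01_cells_le n (phi : R -> R) (c : 'I_n -> R) : (0 < n)%N ->
  intg01 phi ->
  {ae leb, forall t, forall i, cell i t -> phi t <= c i} ->
  \int[leb]_(t in I01) phi t <= n%:R^-1 * \sum_i c i.
Proof.
move=> n0 hphi hc; rewrite -Rintegral01_step.
apply: Rintegral01_ae_le => //; first exact: intg01_step.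
move: (cells_cover n0) hc; apply: filterS2 => t ht hc tI.
by have [i it] := ht tI; rewrite (step_cell _ it) hc.
Qed.

(** The error is given cell by cell: moduli of continuity weighted by [|u_j|] fit in, and [e = 0]
    yields exact integrals of functions that are constant on cells. *)
Lemma Rintegral01_cells n (phi : R -> R) (c e : 'I_n -> R) : (0 < n)%N ->
  intg01 phi ->
  {ae leb, forall t, forall i, cell i t -> `|phi t - c i| <= e i} ->
  `|\int[leb]_(t in I01) phi t - n%:R^-1 * \sum_i c i| <= n%:R^-1 * \sum_i e i.
Proof.
move=> n0 hphi hc; rewrite ler_norml; apply/andP; split.
  have := @Rintegral01_cells_le n (fun t => (-1) * phi t) (fun i => e i - c i) n0.
  rewrite RintegralZl // mulN1r sumrB mulrBr => /(_ (intg01Z _ hphi)).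
  have hc' : {ae leb, forall t, forall i, cell i t -> -1 * phi t <= e i - c i}.
    apply: filterS hc => t h i /h; rewrite ler_norml => /andP[h1 h2]; lra.
  by move=> /(_ hc'); lra.
have := @Rintegral01_cells_le n phi (fun i => e i + c i) n0 hphi.
rewrite big_split /= mulrDr.
have hc' : {ae leb, forall t, forall i, cell i t -> phi t <= e i + c i}.
  apply: filterS hc => t h i /h; rewrite ler_norml => /andP[h1 h2]; lra.
by move=> /(_ hc'); lra.
Qed.

End unit_interval_integral.

(** * Uniform continuity and limits of iterated midpoint sums *)

Section uniform_continuity.
Context {R : realType}.
Notation leb := (@lebesgue_measure R).
Notation I01 := [set` `[0%R : R, 1%R]].

Lemma compact_uniformly_continuous (X : pseudoMetricType R) (A : set X) (f : X -> R) :
  compact A -> {within A, continuous f} -> forall e, 0 < e ->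
  exists2 d, 0 < d & forall x y, A x -> A y -> ball x d y -> `|f x - f y| <= e.
Proof.
move=> /compact_near_coveringP cA /subspace_continuousP cf e e0.
have e20 : 0 < e / 2 by rewrite divr_gt0.
(* Near-covering form of compactness along radii [d] tending to [0] from the right: each point needs
   a neighbourhood and a threshold for [d] that work together; [r / 2] for both does, by the
   triangle inequality. *)
have := cA R (0^'+) (fun d x => A x -> forall y, A y -> ball x d y -> `|f x - f y| <= e) _.
case.
  move=> x Ax.
  have /cvgrPdist_le /(_ _ e20) := cf x Ax.
  rewrite near_withinE /= => /nbhs_ballP[r /= r0 hr].
  have r20 : 0 < r / 2 by rewrite divr_gt0.
  exists (ball x (r / 2), [set d | d < r / 2]) => /=.
    split; first exact: nbhsx_ballx.
    by apply: nbhs_right_lt.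
  move=> [x' d] /= [xx' dr] Ax' y Ay x'y.
  have h1 := hr x' (le_ball _ xx') Ax'.
  have h2 := hr y _ Ay.
  have {}h1 : `|f x - f x'| <= e / 2.
    by apply: h1; rewrite ler_pdivrMr // ler_peMr ?ler1n // ltW.
  have {}h2 : `|f x - f y| <= e / 2.
    apply: h2; rewrite [r]splitr; apply: ball_triangle xx' _.
    by apply: le_ball x'y; exact: ltW.
  have -> : f x' - f y = (f x - f y) - (f x - f x') by ring.
  by apply: le_trans (ler_normB _ _) _; rewrite [e]splitr addrC lerD.
move=> d /= d0 hd; exists (d / 2); first by rewrite divr_gt0.
move=> x y Ax Ay xy; apply: (hd (d / 2)) => //=.
- by rewrite /= sub0r normrN gtr0_norm ?divr_gt0 // ltr_pdivrMr // ltr_pMr // ltr1n.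
- by rewrite divr_gt0.
Qed.

Lemma compact_continuous_bounded (X : topologicalType) (A : set X) (f : X -> R) :
  compact A -> {within A, continuous f} ->
  exists2 M, 0 < M & forall x, A x -> `|f x| <= M.
Proof.
move=> cA cf; have /compact_bounded[M [_ hM]] := continuous_compact cf cA.
exists (Num.max M 0 + 1); first by rewrite ltr_wpDl // le_max lexx orbT.
move=> x Ax; apply: (hM (Num.max M 0 + 1)); last by exists x.
by rewrite (@le_lt_trans _ _ (Num.max M 0)) ?le_max ?lexx // ltrDl.
Qed.

Definition unif_cont01 (g : R -> R) := forall e, 0 < e -> exists2 d, 0 < d &
  forall s t, I01 s -> I01 t -> `|s - t| < d -> `|g s - g t| <= e.

Lemma intg01_unif_cont g : unif_cont01 g -> intg01 g.
Proof.
move=> ug; apply: continuous_compact_integrable; first exact: segment_compact.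
apply/subspace_continuousP => x xI; apply/cvgrPdist_le => e e0.
have [d d0 hd] := ug e e0.
rewrite near_withinE; apply/nbhs_ballP; exists d => // y xy yI.
exact: hd.
Qed.

Lemma Rintegral01_midpoints g e d n : intg01 g -> (0 < n)%N -> n%:R^-1 < d ->
  (forall s t, I01 s -> I01 t -> `|s - t| < d -> `|g s - g t| <= e) ->
  `|\int[leb]_(t in I01) g t - n%:R^-1 * \sum_(i < n) g (midpoint i)| <= e.
Proof.
move=> ig n0 nd hg.
have := @Rintegral01_cells R n g (fun i => g (midpoint i)) (fun=> e) n0 ig.
rewrite sumr_const card_ord -[e *+ n]mulr_natl mulrA mulVf ?pnatr_eq0 -?lt0n // mul1r.
apply; apply: aeW => t i it; apply: hg.
- exact: cell_sub it.
- by rewrite /= in_itv /= midpoint01.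
- exact: lt_trans (cell_midpoint it) nd.
Qed.

Definition cube k (xs : seq R) := (size xs == k) && all (fun x => 0 <= x <= 1) xs.

(** The index [i] is unbounded: past the length both entries default to [0], so those conditions
    hold as soon as [0 < d]. *)
Definition modulus k (F : seq R -> R) (e d : R) := forall xs ys,
  cube k xs -> cube k ys -> (forall i, `|xs`_i - ys`_i| < d) -> `|F xs - F ys| <= e.

Definition unif_cont_cube k F := forall e, 0 < e -> exists2 d, 0 < d & modulus k F e d.

(** Same recursion as [iter_int01], so that the two can be compared by induction on the number of
    variables. *)
Fixpoint midpoint_sum n k (F : seq R -> R) : R :=
  if k is k'.+1 then
    n%:R^-1 * \sum_(i < n) midpoint_sum n k' (fun xs => F (midpoint i :: xs))
  else F [::].

Lemma modulus_cons k F e d x : 0 <= x <= 1 -> 0 < d -> modulus k.+1 F e d ->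
  modulus k (fun xs => F (x :: xs)) e d.
Proof.
move=> x01 d0 mF xs ys /andP[sx ax] /andP[sy ay] xy.
apply: mF; rewrite /cube /= ?eqSS ?sx ?sy ?x01 //.
by case=> [|i] //=; rewrite subrr normr0.
Qed.

Lemma unif_cont_cube_cons k F x : 0 <= x <= 1 -> unif_cont_cube k.+1 F ->
  unif_cont_cube k (fun xs => F (x :: xs)).
Proof.
move=> x01 uF e /uF[d d0 mF]; exists d => //; exact: modulus_cons.
Qed.

Lemma midpoint_sum_le n k F F' e : 0 <= e ->
  (forall xs, cube k xs -> `|F xs - F' xs| <= e) ->
  `|midpoint_sum n k F - midpoint_sum n k F'| <= e.
Proof.
move=> e0; elim: k F F' => [|k IH] F F' FF' /=; first by apply: FF'.
rewrite -mulrBr -sumrB normrM ger0_norm ?invr_ge0 //.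
have [->|n0] := posnP n; first by rewrite big_ord0 normr0 mulr0.
rewrite mulrC ler_pdivrMr ?ltr0n // mulr_natr.
apply: le_trans (ler_norm_sum _ _ _) _.
rewrite -[X in _ *+ X](card_ord n) -sumr_const; apply: ler_sum => i _.
apply: IH => xs /andP[sx ax]; apply: FF'.
by rewrite /cube /= eqSS sx midpoint01.
Qed.

Lemma inv_lt_near (d : R) : 0 < d -> \forall n \near \oo, (0 < n)%N /\ n%:R^-1 < d.
Proof.
move=> d0; near=> n.
have n0 : (0 < n)%N by near: n; exists 1%N.
split=> //; rewrite -[d]invrK ltf_pV2 ?posrE ?invr_gt0 ?ltr0n //.
near: n; exact: nbhs_infty_gtr.
Unshelve. all: by end_near. Qed.

(** Each variable contributes one error [e]. The induction needs the inner integral [G] to inherit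
    every modulus of [F], which makes it integrable and close to its own midpoint sum. *)
Lemma midpoint_sum_dist k F : unif_cont_cube k F ->
  forall e d n, 0 < d -> modulus k F e d -> (0 < n)%N -> n%:R^-1 < d ->
  `|midpoint_sum n k F - iter_int01 k F| <= k%:R * e.
Proof.
elim: k F => [|k IH] F uF e d n d0 mF n0 nd /=; first by rewrite subrr normr0 mul0r.
pose G t := iter_int01 k (fun xs => F (t :: xs)).
(* Monotonicity of the iterated integral would require integrability at every level. Instead the
   induction hypothesis approximates [G s] and [G t] arbitrarily well by midpoint sums, and these
   differ by at most [e']. *)
have close s t e' d' : I01 s -> I01 t -> modulus k.+1 F e' d' -> `|s - t| < d' ->
    `|G s - G t| <= e'.
  rewrite /= !in_itv /= => s01 t01 mF' st.
  have d'0 : 0 < d' by exact: le_lt_trans st.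
  apply/ler_addgt0Pr => eta eta0.
  (* Two approximations, each with error [k q], must fit into [eta]; the denominator [2 k + 1] also
     covers [k = 0]. *)
  have [q q0 qeta] : exists2 q, 0 < q & k%:R * q + k%:R * q <= eta.
    have k0 : 0 < 2 * k%:R + 1 :> R by rewrite ltr_wpDl // mulr_ge0.
    have q0 : 0 < eta / (2 * k%:R + 1) by rewrite divr_gt0.
    exists (eta / (2 * k%:R + 1)) => //.
    have : eta / (2 * k%:R + 1) * (2 * k%:R + 1) = eta by rewrite divfK ?gt_eqF.
    by move: q0; set q := eta / _ => q0; lra.
  have [r r0 mr] := uF q q0.
  have [m [m0 mlt]] : exists m, (0 < m)%N /\ m%:R^-1 < r.
    by have [m _ /(_ m (leqnn _))] := inv_lt_near r0; exists m.
  have hs := IH _ (unif_cont_cube_cons s01 uF) q r m r0 (modulus_cons s01 r0 mr) m0 mlt.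
  have ht := IH _ (unif_cont_cube_cons t01 uF) q r m r0 (modulus_cons t01 r0 mr) m0 mlt.
  have e'0 : 0 <= e'.
    pose z := nseq k.+1 (0 : R).
    have cz : cube k.+1 z by rewrite /cube size_nseq eqxx all_nseq lexx ler01 orbT.
    by apply: le_trans (mF' z z cz cz _) => // i; rewrite subrr normr0.
  have hst := @midpoint_sum_le m k (fun xs => F (s :: xs)) (fun xs => F (t :: xs)) e' e'0.
  set a := midpoint_sum m k _ in hs hst; set b := midpoint_sum m k _ in ht hst.
  have {}hst : `|a - b| <= e'.
    apply: hst => xs /andP[sx ax]; apply: mF'; rewrite /cube /= ?eqSS ?sx ?s01 ?t01 //.
    by case=> [|i] //=; rewrite subrr normr0.
  have -> : G s - G t = (a - b) + ((b - G t) - (a - G s)) by ring.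
  apply: le_trans (ler_normD _ _) _; apply: lerD => //.
  apply: le_trans (ler_normB _ _) _; apply: le_trans qeta; exact: lerD.
have uG : unif_cont01 G.
  move=> e' e'0; have [d' d'0 mF'] := uF e' e'0.
  by exists d' => // s t sI tI st; exact: (close s t e' d').
have hG := @Rintegral01_midpoints G e d n (intg01_unif_cont uG) n0 nd
   (fun s t sI tI => close s t e d sI tI mF).
rewrite -addn1 natrD mulrDl mul1r.
rewrite distrC in hG.
set J := \int[leb]_(t in I01) _ in hG *.
set X := _ * \sum_(i < n) midpoint_sum _ _ _.
set Y := _ * \sum_(i < n) G _ in hG.
have -> : X - J = (X - Y) + (Y - J) by ring.
apply: le_trans (ler_normD _ _) _; apply: lerD => //.
rewrite /X /Y -mulrBr -sumrB normrM ger0_norm ?invr_ge0 //.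
rewrite mulrC ler_pdivrMr ?ltr0n // mulr_natr.
apply: le_trans (ler_norm_sum _ _ _) _.
rewrite -[X in _ *+ X](card_ord n) -sumr_const; apply: ler_sum => i _.
apply: (IH _ _ e d) => //.
  by apply: unif_cont_cube_cons => //; exact: midpoint01.
by apply: modulus_cons => //; exact: midpoint01.
Qed.

Lemma midpoint_sum_cvg k F : unif_cont_cube k F ->
  midpoint_sum n k F @[n --> \oo] --> iter_int01 k F.
Proof.
move=> uF; apply/cvgrPdist_le => e e0.
have e'0 : 0 < e / k.+1%:R by rewrite divr_gt0.
have [d d0 mF] := uF _ e'0.
move: (inv_lt_near d0); apply: filterS => n [n0 nd].
rewrite distrC; apply: le_trans (midpoint_sum_dist uF d0 mF n0 nd) _.
rewrite mulrCA -[leRHS]mulr1 ler_pM2l // ler_pdivrMr // mul1r ler_nat.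
exact: leqnSn.
Qed.

Lemma midpoint_sum_tuples n k F : midpoint_sum n k F =
  n%:R^-1 ^+ k * \sum_(t : k.-tuple 'I_n) F [seq midpoint i | i <- t].
Proof.
elim: k F => [|k IH] F /=.
  rewrite expr0 mul1r (big_pred1 [tuple]) // => t.
  by apply/esym/eqP; rewrite [t]tuple0.
rewrite exprS -mulrA; congr (_ * _).
under eq_bigr do rewrite IH.
rewrite -mulr_sumr; congr (_ * _).
rewrite pair_bigA /=.
rewrite [RHS](reindex (fun p : 'I_n * k.-tuple 'I_n => [tuple of p.1 :: p.2])) //.
exists (fun t => (thead t, [tuple of behead t])) => [[i t] _|t _] /=.
  by congr pair; apply/val_inj.
by rewrite -tuple_eta.
Qed.

End uniform_continuity.

(** * Dominated convergence of series *)

Section dominated_series.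
Context {R : realType}.

Lemma series_dist_le (u b : R^nat) N m : (forall k, `|u k| <= b k) -> (N <= m)%N ->
  `|series u m - series u N| <= series b m - series b N.
Proof.
move=> ub Nm; rewrite !sub_series_geq //.
by apply: le_trans (ler_norm_sum _ _ _) _; apply: ler_sum => i _.
Qed.

Lemma cvg_norm_le (u : R^nat) l c : u n @[n --> \oo] --> l ->
  (\forall n \near \oo, `|u n| <= c) -> `|l| <= c.
Proof.
move=> /cvgrPdist_le ul uc; apply/ler_addgt0Pr => e e0.
have [n [hn cn]] := filter_ex (filterI (ul e e0) uc).
have -> : l = u n + (l - u n) by ring.
by apply: le_trans (ler_normD _ _) _; exact: lerD.
Qed.

Lemma cvg_lower_bound (u : R^nat) l c : u n @[n --> \oo] --> l ->
  (\forall n \near \oo, c <= u n) -> c <= l.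
Proof.
move=> /cvgrPdist_le ul uc; apply/ler_addgt0Pr => e e0.
have [n [hn cn]] := filter_ex (filterI (ul e e0) uc).
by move: hn; rewrite ler_norml => /andP[]; lra.
Qed.

(** Tannery's theorem: tail of the limit series, finitely many convergent terms, tail of the [n]-th
    series, a third of [e] each. The hypothesis on [d] fits finite expansions, whose partial sums
    are eventually constant. *)
Lemma dominated_series_cvg (a : nat -> R^nat) (T b d : R^nat) :
  (forall k, a n k @[n --> \oo] --> T k) ->
  (forall n k, `|a n k| <= b k) -> cvgn (series b) ->
  (forall n, \forall N \near \oo, d n = series (a n) N) ->
  cvgn (series T) /\ d n @[n --> \oo] --> limn (series T).
Proof.
move=> aT ab cb da.
have Tb k : `|T k| <= b k.
  by apply: (cvg_norm_le (aT k)); exact: nearW.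
have cT : cvgn (series T).
  apply: normed_cvg; apply: (series_le_cvg _ _ Tb cb) => k //.
  exact: le_trans (Tb k).
split=> //; apply/cvgrPdist_le => e e0.
have e30 : 0 < e / 3 by rewrite divr_gt0.
have [N tail] : exists N, forall m, (N <= m)%N -> series b m - series b N <= e / 3.
  have /cvgrPdist_le /(_ _ (divr_gt0 e30 (ltr0n _ 2))) [N _ hN] := cb.
  exists N => m Nm.
  have h1 := hN m Nm; have h2 := hN N (leqnn N).
  move: h1 h2; rewrite !ler_norml => /andP[h1 h2] /andP[h3 h4]; lra.
have hT : `|limn (series T) - series T N| <= e / 3.
  have cTN : (series T m - series T N) @[m --> \oo] --> limn (series T) - series T N.
    by apply: cvgB => //; exact: cvg_cst.
  apply: (cvg_norm_le cTN); exists N => // m Nm.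
  exact: le_trans (series_dist_le Tb Nm) (tail _ Nm).
have hN : \forall n \near \oo, `|series T N - series (a n) N| <= e / 3.
  have : series (a n) N @[n --> \oo] --> series T N.
    elim: N {tail hT} => [|N IH].
      rewrite /series /=; under eq_fun do rewrite big_geq //.
      by rewrite big_geq //; exact: cvg_cst.
    under eq_fun do rewrite seriesSr.
    by rewrite seriesSr; apply: cvgD.
  by move/cvgrPdist_le; apply.
move: hN; apply: filterS => n hn.
have [N' _ hN'] := da n.
have Nm : (N <= maxn N N')%N by rewrite leq_maxl.
have := le_trans (series_dist_le (ab n) Nm) (tail _ Nm).
rewrite -(hN' (maxn N N')) /= ?leq_maxr // distrC => hd.
have -> : limn (series T) - d n = (limn (series T) - series T N)
   + (series T N - series (a n) N) + (series (a n) N - d n) by ring.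
apply: le_trans (ler_normD _ _) _.
have := ler_normD (limn (series T) - series T N) (series T N - series (a n) N).
lra.
Qed.

(** The classical majorant [k^(k/2) |M|^k / k!] of the Fredholm terms. *)
Definition hadamard_bound (M : R) k := Num.sqrt ((k%:R * M ^+ 2) ^+ k) / k`!%:R.

(** The left side is a single term of the exponential series at [k]. *)
Lemma exprn_fact_le k : (k%:R : R) ^+ k / k`!%:R <= expR k%:R.
Proof.
have := @nondecreasing_cvgn_le R (series (exp_coeff (k%:R : R))) _ _ k.+1.
rewrite -/(expR _) => h.
have {}h : series (exp_coeff (k%:R : R)) k.+1 <= expR k%:R.
  apply: h; last exact: is_cvg_series_exp_coeff.
  apply: nondecreasing_series => i _ _; rewrite /exp_coeff /=.
  by rewrite divr_ge0 // exprn_ge0.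
apply: le_trans h; rewrite /series /= big_nat_recr //= lerDr.
by apply: sumr_ge0 => i _; rewrite /exp_coeff /= divr_ge0 // exprn_ge0.
Qed.

(* By AM-GM, b_k <= (4^-k + 4^k b_k^2) / 2, where b_k^2 <= (e M^2)^k / k! because
   k^k / k! <= e^k. *)
Lemma cvg_hadamard_bound M : cvgn (series (hadamard_bound M)).
Proof.
pose c : R := 4 * expR 1 * M ^+ 2.
pose w k : R := geometric 1 (1 / 4) k + exp_coeff c k.
have b0 k : 0 <= hadamard_bound M k by rewrite divr_ge0 ?sqrtr_ge0.
apply: (@series_le_cvg _ _ w) => // [k||].
- have c0 : 0 <= c.
    by apply: mulr_ge0; [apply: mulr_ge0 => //; exact: expR_ge0 | exact: sqr_ge0].
  rewrite /w addr_ge0 // /geometric /exp_coeff /=.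
    by rewrite mul1r exprn_ge0.
  by rewrite divr_ge0 // exprn_ge0.
- move=> k; set b := hadamard_bound M k.
  have hb : b ^+ 2 <= (expR 1 * M ^+ 2) ^+ k / k`!%:R.
    rewrite /b /hadamard_bound expr_div_n sqr_sqrtr; last first.
      by rewrite exprn_ge0 // mulr_ge0 ?sqr_ge0.
    have f0 : 0 < k`!%:R :> R by rewrite ltr0n fact_gt0.
    have -> : (k%:R * M ^+ 2) ^+ k / k`!%:R ^+ 2 =
       (k%:R ^+ k / k`!%:R) * ((M ^+ 2) ^+ k / k`!%:R).
      by rewrite exprMn; field; rewrite gt_eqF.
    rewrite [(expR 1 * _) ^+ k]exprMn -expRM_natl mulr1 -[leRHS]mulrA ler_wpM2r ?exprn_fact_le //.
    by apply: divr_ge0 => //; apply: exprn_ge0; exact: sqr_ge0.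
  have h4 : 0 < 4 ^+ k :> R by rewrite exprn_gt0.
  have := sqr_ge0 (4 ^+ k * b - 1).
  rewrite /w /geometric /exp_coeff /= mul1r expr_div_n expr1n.
  rewrite /c -[4 * _ * _]mulrA exprMn -mulrA.
  set X := (expR 1 * M ^+ 2) ^+ k / k`!%:R in hb *; set q := 4 ^+ k in h4 *.
  move=> h5; rewrite -(ler_pM2l h4) mulrDr mul1r mulfV ?gt_eqF //.
  have : q * (q * b ^+ 2) <= q * (q * X) by rewrite !ler_pM2l.
  by move: (b0 k); rewrite -/b; nra.
- rewrite (_ : series w = series (geometric 1 (1 / 4)) + series (exp_coeff c)); last first.
    by apply/funext => n; rewrite /series /= big_split.
  apply: is_cvgD; last exact: is_cvg_series_exp_coeff.
  by apply: is_cvg_geometric_series; rewrite ger0_norm; lra.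
Qed.

End dominated_series.

(** * Operators on L^2[0,1] and their discretization *)

Section L2_operators.
Context {R : realType}.
Notation leb := (@lebesgue_measure R).
Notation I01 := [set` `[0%R : R, 1%R]].

Lemma ae_mu01 (P : R -> Prop) : {ae (@mu01 R), forall t, P t} ->
  {ae leb, forall t, I01 t -> P t}.
Proof.
move=> [N [mN N0 PN]]; exists (N `&` I01); split.
- by apply: measurableI => //; exact: measurable_itv.
- exact: N0.
- by move=> t /= /not_implyP[tI nP]; split => //; exact: PN.
Qed.

(** The complement of [[0,1]] is null for [mu01], and on subsets of [[0,1]] the two measures
    agree. *)
Lemma ge0_integral_mu01 (f : R -> \bar R) :
  measurable_fun [set: measurableTypeR R] f -> (forall t, (0 <= f t)%E) ->
  (\int[@mu01 R]_t f t = \int[leb]_(t in I01) f t)%E.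
Proof.
move=> mf f0.
have mI : measurable (I01 : set (measurableTypeR R)) by exact: measurable_itv.
have mCI : measurable (~` I01 : set (measurableTypeR R)) by exact: measurableC.
have CI0 : @mu01 R (~` I01) = 0%E by rewrite /mu01 /= /mrestr setICl measure0.
rewrite (@ge0_negligible_integral _ _ _ (@mu01 R) setT (~` I01) f) //.
rewrite setTD setCK; apply: eq_measure_integral => B mB BI.
by rewrite /mu01 /= /mrestr setIidl.
Qed.

Lemma L2_measurable (f : L2 R) D : measurable_fun D (f : measurableTypeR R -> R).
Proof. by apply: measurable_funTS. Qed.

Lemma intg01_mul (f g : L2 R) : intg01 (fun t => f t * g t).
Proof.
have /Lfun1_integrable/integrableP[mfg ifg] := Lfun2_mul_Lfun1 (LfunP f) (LfunP g).
apply/integrableP; split.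
  apply/measurable_EFinP.
  by apply: measurable_funM; exact: L2_measurable.
by rewrite ge0_integral_mu01 // in ifg; exact: measurableT_comp.
Qed.

Lemma ipC (f g : L2 R) : ip f g = ip g f.
Proof. by apply: eq_Rintegral => t _; rewrite mulrC. Qed.

Lemma ip_lin (a : R) (f g h : L2 R) : ip (a *: f + g) h = a * ip f h + ip g h.
Proof.
rewrite /ip -RintegralZl; [|exact: measurable_itv|exact: intg01_mul].
rewrite -RintegralD.
- by apply: eq_Rintegral => t _; rewrite /= mulrDl mulrA.
- exact: measurable_itv.
- by apply: intg01Z; exact: intg01_mul.
- exact: intg01_mul.
Qed.

Lemma ip_ge0 (f : L2 R) : 0 <= ip f f.
Proof. by apply: Rintegral_ge0 => t _; rewrite -expr2 sqr_ge0. Qed.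

Lemma ip_ae (f g h : L2 R) : {ae (@mu01 R), forall t, g t = h t} ->
  ip f g = ip f h.
Proof.
move=> /ae_mu01 gh; rewrite /ip; have [|||_ ->] := 
  @Rintegral01_ae_eq R (fun t => f t * g t) (fun t => f t * h t).
- exact: intg01_mul.
- by apply: measurable_funM; exact: L2_measurable.
- by apply: filterS gh => t + tI => ->.
- by [].
Qed.

Lemma Lnorm2_ip (f : L2 R) : ('N[@mu01 R]_2%:E[EFin \o f] `^ 2 = (ip f f)%:E)%E.
Proof.
rewrite poweR_Lnorm // ge0_integral_mu01; last 2 first.
- apply/measurable_EFinP => /=.
  apply: (@measurableT_comp _ _ _ _ _ _ (fun x : R => x `^ 2)%R) => //.
  by apply: measurableT_comp => //; exact: L2_measurable.
- by move=> t; exact: poweR_ge0.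
rewrite /ip /Rintegral fineK; last first.
  by apply: integrable_fin_num; [exact: measurable_itv | exact: intg01_mul].
apply: eq_integral => t _ /=.
by rewrite -[X in X `^ _]/(`|f t|) powR_mulrn // real_normK ?num_real // expr2.
Qed.

Lemma bounded_operator_ip (T : L2 R -> L2 R) : bounded_operator T ->
  exists2 C, 0 < C & forall f, ip (T f) (T f) <= C ^+ 2 * ip f f.
Proof.
(* The given [C] may be negative or zero; [|C| + 1] is positive, so it can be squared monotonically
   and inverted later. *)
move=> [_ _ [C hC]]; exists (`|C| + 1); first by rewrite ltr_wpDl.
move=> f; rewrite -lee_fin EFinM -!Lnorm2_ip.
have h : ('N[@mu01 R]_2%:E[EFin \o T f] <= (`|C| + 1)%:E * 'N[@mu01 R]_2%:E[EFin \o f])%E.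
  apply: le_trans (hC f) _; apply: lee_wpmul2r; first exact: Lnorm_ge0.
  by rewrite lee_fin (le_trans (ler_norm C)) // lerDl.
have C0 : 0 <= `|C| + 1 by rewrite addr_ge0.
have -> : ((`|C| + 1) ^+ 2)%:E = ((`|C| + 1)%:E `^ 2)%E by rewrite poweR_EFin powR_mulrn.
rewrite -poweRM ?lee_fin ?Lnorm_ge0 //.
apply: gt0_ler_poweR => //; rewrite in_itv /= leey andbT ?Lnorm_ge0 //.
by rewrite mule_ge0 ?lee_fin ?Lnorm_ge0.
Qed.

(** Positive definiteness alone leaves no gap above [0]; the bound [C] of the inverse supplies one,
    of size [1 / C]. *)
Lemma positive_operator_coercive (A B : L2 R -> L2 R) :
  bounded_operator A -> positive_definite A -> self_adjoint A ->
  inverse_operator A B ->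
  exists2 c, 0 < c & forall g, c * ip g g <= ip g (A g).
Proof.
move=> [_ linA _] posA symA [boundB _ AB].
have [C C0 hC] := bounded_operator_ip boundB.
exists C^-1; first by rewrite invr_gt0.
move=> g; pose h := (- C) *: g + B g.
have h0 : 0 <= ip h (A h).
  (* Positive definiteness speaks of nonzero elements; for a null [h] the form is [0]. *)
  have [hz|hnz] := pselect {ae (@mu01 R), forall t, h t = 0}; last exact/ltW/posA.
  rewrite /ip; have [|||_ ->] := @Rintegral01_ae_eq R (fun t => h t * A h t) (fun=> 0).
  - exact: intg01_mul.
  - exact: measurable_cst.
  - by move/ae_mu01: hz; apply: filterS => t + tI => -> //; rewrite mul0r.
  - by apply: Rintegral_ge0.
have Ah : ip h (A h) = ip h ((- C) *: A g + g).
  apply: ip_ae; have := linA (- C) g (B g); have := AB g.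
  by apply: filterS2 => t h1 h2; rewrite h2 h1.
have e1 : ip (B g) (A g) = ip g g.
  by rewrite ipC symA (ip_ae _ (AB g)).
have e2 : ip h (A h) = C ^+ 2 * ip g (A g) - 2 * C * ip g g + ip (B g) g.
  rewrite Ah ipC ip_lin [ip (A g) h]ipC [ip g h]ipC !ip_lin e1.
  by ring.
have h1 : 0 <= ip h h by exact: ip_ge0.
have e3 : ip h h = ip (B g) (B g) - 2 * C * ip (B g) g + C ^+ 2 * ip g g.
  rewrite {1}/h ip_lin [ip g h]ipC [ip (B g) h]ipC /h !ip_lin [ip g (B g)]ipC.
  by ring.
have h2 := hC g.
rewrite -(ler_pM2l (exprn_gt0 2 C0)) mulrA.
have -> : C ^+ 2 / C = C by field; rewrite gt_eqF.
(* From [0 <= |B g - C g|^2] and [|B g| <= C |g|], in place of the Cauchy-Schwarz inequality. *)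
have h3 : C * ip (B g) g <= C * (C * ip g g) by rewrite e3 in h1; lra.
rewrite ler_pM2l // in h3; rewrite e2 in h0; lra.
Qed.

Lemma step_Lfun n (c : 'I_n -> R) : step c \in Lfun (@mu01 R) 2%:E.
Proof.
have ms : measurable_fun [set: measurableTypeR R] (step c) by exact: measurable_step.
rewrite inE; apply/andP; split; rewrite inE //=.
rewrite /finite_norm unlock poweR_lty // ge0_integral_mu01; last 2 first.
- apply/measurable_EFinP => /=.
  apply: (@measurableT_comp _ _ _ _ _ _ (fun x : R => x `^ 2)%R) => //.
  by apply: measurableT_comp.
- by move=> t; exact: poweR_ge0.
have : intg01 (fun t => step c t * step c t).
  apply: (@intg01_bounded _ _ ((\sum_i `|c i|) * (\sum_i `|c i|))).
    by apply: measurable_funM; exact: measurable_step.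
  move=> t _; rewrite normrM.
  have s0 : 0 <= \sum_i `|c i| by exact: sumr_ge0.
  have h : `|step c t| <= \sum_i `|c i|.
    by apply: step_le => // i; rewrite (bigD1 i) //= lerDl sumr_ge0.
  exact: ler_pM.
move/integrableP => [_]; apply: le_lt_trans; rewrite le_eqVlt; apply/orP; left.
apply/eqP; apply: eq_integral => t _ /=.
by rewrite powR_mulrn // normrM expr2.
Qed.

Definition stepL2 n (c : 'I_n -> R) : L2 R := Lfun_Sub le1_2E (step_Lfun c).

End L2_operators.

(** * Bounded uniformly continuous functions on the cube *)

Section bounded_moduli.
Context {R : realType}.
Implicit Types F G : seq R -> R.

(** Boundedness is carried along because the modulus of a product involves it; the class is then
    closed under the operations that build a determinant. *)
Definition bounded_unif_cont k F :=
  (exists2 B, 0 < B & forall xs, cube k xs -> `|F xs| <= B) /\ unif_cont_cube k F.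

Lemma bounded_unif_cont_cst k (c : R) : bounded_unif_cont k (fun=> c).
Proof.
split; first by exists (`|c| + 1) => [|xs _]; rewrite ?ltr_wpDl // lerDl.
by move=> e e0; exists 1 => // xs ys _ _ _; rewrite subrr normr0 ltW.
Qed.

Lemma bounded_unif_contD k F G : bounded_unif_cont k F -> bounded_unif_cont k G ->
  bounded_unif_cont k (fun xs => F xs + G xs).
Proof.
move=> [[BF BF0 bF] uF] [[BG BG0 bG] uG]; split.
  exists (BF + BG); first exact: addr_gt0.
  by move=> xs cx; apply: le_trans (ler_normD _ _) _; rewrite lerD ?bF ?bG.
move=> e e0; have e20 : 0 < e / 2 by rewrite divr_gt0.
have [d1 d10 m1] := uF _ e20; have [d2 d20 m2] := uG _ e20.
exists (Num.min d1 d2); first by rewrite lt_min d10.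
move=> xs ys cx cy xy.
have h1 : `|F xs - F ys| <= e / 2.
  by apply: m1 => // i; have := xy i; rewrite lt_min => /andP[].
have h2 : `|G xs - G ys| <= e / 2.
  by apply: m2 => // i; have := xy i; rewrite lt_min => /andP[].
have -> : F xs + G xs - (F ys + G ys) = (F xs - F ys) + (G xs - G ys) by ring.
by apply: le_trans (ler_normD _ _) _; rewrite [e]splitr lerD.
Qed.

Lemma bounded_unif_contM k F G : bounded_unif_cont k F -> bounded_unif_cont k G ->
  bounded_unif_cont k (fun xs => F xs * G xs).
Proof.
move=> [[BF BF0 bF] uF] [[BG BG0 bG] uG]; split.
  exists (BF * BG); first exact: mulr_gt0.
  by move=> xs cx; rewrite normrM ler_pM ?bF ?bG.
move=> e e0.
have e10 : 0 < e / 2 / BG by rewrite !divr_gt0.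
have e20 : 0 < e / 2 / BF by rewrite !divr_gt0.
have [d1 d10 m1] := uF _ e10; have [d2 d20 m2] := uG _ e20.
exists (Num.min d1 d2); first by rewrite lt_min d10.
move=> xs ys cx cy xy.
have h1 : `|F xs - F ys| <= e / 2 / BG.
  by apply: m1 => // i; have := xy i; rewrite lt_min => /andP[].
have h2 : `|G xs - G ys| <= e / 2 / BF.
  by apply: m2 => // i; have := xy i; rewrite lt_min => /andP[].
have -> : F xs * G xs - F ys * G ys = (F xs - F ys) * G xs + F ys * (G xs - G ys) by ring.
apply: le_trans (ler_normD _ _) _; rewrite [leRHS]splitr !normrM lerD //.
  have -> : e / 2 = e / 2 / BG * BG by rewrite divfK ?gt_eqF.
  by rewrite ler_pM ?bG.
have -> : e / 2 = BF * (e / 2 / BF) by rewrite [RHS]mulrC divfK ?gt_eqF.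
by rewrite ler_pM ?bF.
Qed.

Lemma bounded_unif_cont_det k m (E : 'I_m -> 'I_m -> seq R -> R) :
  (forall p q, bounded_unif_cont k (E p q)) ->
  bounded_unif_cont k (fun xs => \det (\matrix_(p, q) E p q xs)).
Proof.
move=> gE; rewrite /determinant.
under eq_fun do under eq_bigr do under eq_bigr do rewrite mxE.
elim: (index_enum _) => [|s r IH].
  by under eq_fun do rewrite big_nil; exact: bounded_unif_cont_cst.
under eq_fun do rewrite big_cons.
apply: bounded_unif_contD => //; apply: bounded_unif_contM.
  exact: bounded_unif_cont_cst.
elim: (index_enum _) => [|i r' IH'].
  by under eq_fun do rewrite big_nil; exact: bounded_unif_cont_cst.
under eq_fun do rewrite big_cons.
exact: bounded_unif_contM.
Qed.

Lemma cube_nth k (xs : seq R) i : cube k xs -> (i < k)%N -> 0 <= xs`_i <= 1.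
Proof. by move=> /andP[/eqP sx /all_nthP h] ik; apply: h; rewrite sx. Qed.

Lemma continuous_unif_cont01 (g : R -> R) :
  {within `[0 : R, 1], continuous g} -> unif_cont01 g.
Proof.
move=> cg e e0.
have [d d0 hd] := compact_uniformly_continuous (@segment_compact R 0 1) cg e0.
by exists d => // s t sI tI st; exact: hd.
Qed.

Lemma bounded_unif_cont1 (g : R -> R) k p : (p < k)%N ->
  {within `[0 : R, 1], continuous g} -> bounded_unif_cont k (fun xs => g xs`_p).
Proof.
move=> pk cg; split.
  have [M M0 hM] := compact_continuous_bounded (@segment_compact R 0 1) cg.
  by exists M => // xs cx; apply: hM; rewrite /= in_itv /= (cube_nth cx).
move=> e /(continuous_unif_cont01 cg) [d d0 hd]; exists d => // xs ys cx cy xy.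
by apply: hd => //; rewrite /= in_itv /= (@cube_nth k).
Qed.

Lemma bounded_unif_cont2 (K : R -> R -> R) k p q : (p < k)%N -> (q < k)%N ->
  {within [set` `[0 : R, 1]] `*` [set` `[0 : R, 1]],
     continuous (fun z : R * R => K z.1 z.2)} ->
  bounded_unif_cont k (fun xs => K xs`_p xs`_q).
Proof.
move=> pk qk cK.
have cI := compact_setX (@segment_compact R 0 1) (@segment_compact R 0 1).
split.
  have [M M0 hM] := compact_continuous_bounded cI cK.
  exists M => // xs cx; apply: (hM (xs`_p, xs`_q)).
  by split; rewrite /= in_itv /= (cube_nth cx).
move=> e /(compact_uniformly_continuous cI cK) [d d0 hd]; exists d => // xs ys cx cy xy.
apply: (hd (xs`_p, xs`_q) (ys`_p, ys`_q)).
- by split; rewrite /= in_itv /= (cube_nth cx).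
- by split; rewrite /= in_itv /= (cube_nth cy).
- by split; exact: xy.
Qed.

End bounded_moduli.

(** * Comparison of the operator with its midpoint matrices *)

Section discretization.
Context {R : realType}.
Variables (A B : L2 R -> L2 R) (D : R -> R) (Dinf Dsup : R) (K : R -> R -> R).
Notation leb := (@lebesgue_measure R).
Notation I01 := [set` `[0%R : R, 1%R]].
Hypotheses (hA : bounded_operator A) (hApos : positive_definite A).
Hypotheses (hAself : self_adjoint A) (hAinv : inverse_operator A B).
Hypothesis hAdec : decomposes A D K.
Hypothesis hDcont : {within `[0 : R, 1], continuous D}.
Hypothesis hDinf : 0 < Dinf.
Hypothesis hD : forall t : R, 0 <= t <= 1 -> Dinf < D t < Dsup.
Hypothesis hKcont : {within [set` `[0 : R, 1]] `*` [set` `[0 : R, 1]],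
  continuous (fun z : R * R => K z.1 z.2)}.
Hypothesis hKsym : forall s t : R, 0 <= s <= 1 -> 0 <= t <= 1 -> K s t = K t s.

Lemma intg01_slice n (u : 'I_n -> R) t : I01 t ->
  intg01 (fun s => K t s * (D s * step u s)).
Proof.
move=> tI.
have uKt : unif_cont01 (K t).
  have [_ uK] := @bounded_unif_cont2 R K 2 0 1 isT isT hKcont.
  move=> e /uK[d d0 hd]; exists d => // s s' sI s'I ss'.
  have ti : 0 <= t <= 1 by move: tI; rewrite /= in_itv.
  have si : 0 <= s <= 1 by move: sI; rewrite /= in_itv.
  have s'i : 0 <= s' <= 1 by move: s'I; rewrite /= in_itv.
  apply: (hd [:: t; s] [:: t; s']); rewrite /cube /= ?ti ?si ?s'i //.
  by case=> [|[|i]] //=; rewrite subrr normr0.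
have mK : measurable_fun I01 (K t).
  by apply/measurable_EFinP; exact: (measurable_int _ (intg01_unif_cont uKt)).
have mD : measurable_fun I01 D.
  apply/measurable_EFinP.
  exact: (measurable_int _ (intg01_unif_cont (continuous_unif_cont01 hDcont))).
have [MK MK0 bK] := compact_continuous_bounded
   (compact_setX (@segment_compact R 0 1) (@segment_compact R 0 1)) hKcont.
apply: (@intg01_bounded _ _ (MK * (Dsup * \sum_i `|u i|))).
  apply: measurable_funM => //; apply: measurable_funM => //.
  exact: measurable_step.
move=> s sI; rewrite !normrM; apply: ler_pM => //.
  by apply: (bK (t, s)); split.
have si : 0 <= s <= 1 by move: sI; rewrite /= in_itv.
have /andP[d1 d2] := hD si.
apply: ler_pM => //; first by rewrite gtr0_norm ?(ltW d2) // (lt_trans hDinf).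
apply: step_le => [i|]; last exact: sumr_ge0.
by rewrite (bigD1 i) //= lerDl sumr_ge0.
Qed.

(** On a cell, [A g] is [D(t)^2 u_i] plus the integral of [D(t) K(t,s) D(s) g(s)]. Moving [t] and
    [s] to midpoints costs the modulus of [D^2] times [|u_i|] and the modulus of [D K D] times the
    mean of [|u|]. The error stays expressed in [u], for use with quadratic means as well as with a
    sup bound. *)
Lemma operator_step_approx eta : 0 < eta ->
  \forall n \near \oo, forall u : 'cV[R]_n,
    {ae leb, forall t, forall i, cell i t ->
      `|A (stepL2 (u^~ 0)) t - (Mmx D K n *m u) i 0| <=
        eta * (`|u i 0| + n%:R^-1 * \sum_j `|u j 0|)}.
Proof.
move=> eta0.
have gD p : (p < 2)%N -> bounded_unif_cont 2 (fun xs => D xs`_p).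
  by move=> p2; exact: bounded_unif_cont1.
have [_ uQ] := bounded_unif_contM (bounded_unif_contM (gD 0 isT)
   (@bounded_unif_cont2 R K 2 0 1 isT isT hKcont)) (gD 1%N isT).
have [_ uE] := bounded_unif_contM (gD 0 isT) (gD 0 isT).
have [d1 d10 m1] := uQ _ eta0; have [d2 d20 m2] := uE _ eta0.
have d0 : 0 < Num.min d1 d2 by rewrite lt_min d10.
move: (inv_lt_near d0); apply: filterS => n [n0]; rewrite lt_min => /andP[nd1 nd2] u.
pose g := stepL2 (u^~ 0).
have := ae_mu01 (hAdec g); apply: filterS => t ht i it.
have tI : I01 t by exact: cell_sub it.
have t01 : 0 <= t <= 1 by move: tI; rewrite /= in_itv.
have gt : g t = u i 0 by exact: step_cell.
have xi := cell_midpoint it.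
have -> : A g t = D t * (D t * u i 0 +
    \int[leb]_(s in I01) (K t s * (D s * step (u^~ 0) s))).
  by rewrite ht // -gt.
pose Q s r := D s * K s r * D r.
have -> : (Mmx D K n *m u) i 0 =
    n%:R^-1 * \sum_j (Q (midpoint i) (midpoint j) * u j 0) + D (midpoint i) ^+ 2 * u i 0.
  rewrite mxE.
  under eq_bigr do rewrite mxE mulrDl.
  rewrite big_split /= mulr_sumr; congr (_ + _).
    by apply: eq_bigr => j _; rewrite /Q; ring.
  rewrite (bigD1 i) //= eqxx mulr1 big1 ?addr0 // => j ji.
  by rewrite eq_sym (negbTE ji) mulr0 mul0r.
have hE : `|D t ^+ 2 - D (midpoint i) ^+ 2| <= eta.
  rewrite !expr2; apply: (m2 [:: t; t] [:: midpoint i; midpoint i]);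
    rewrite /cube /= ?t01 ?midpoint01 //.
  by case=> [|[|[|k]]] //=; rewrite ?subrr ?normr0 //; apply: lt_trans xi nd2.
pose phi s := D t * (K t s * (D s * step (u^~ 0) s)).
have iphi : intg01 phi by apply: intg01Z; exact: intg01_slice.
have hJ : `|\int[leb]_(s in I01) phi s
     - n%:R^-1 * \sum_j (Q (midpoint i) (midpoint j) * u j 0)|
     <= n%:R^-1 * \sum_j (eta * `|u j 0|).
  apply: Rintegral01_cells => //; apply: aeW => s j js.
  have s01 : 0 <= s <= 1 by have := cell_sub js; rewrite /= in_itv.
  rewrite /phi (step_cell _ js).
  have -> : D t * (K t s * (D s * u j 0)) - Q (midpoint i) (midpoint j) * u j 0
     = (Q t s - Q (midpoint i) (midpoint j)) * u j 0 by rewrite /Q; ring.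
  rewrite normrM ler_wpM2r //.
  apply: (m1 [:: t; s] [:: midpoint i; midpoint j]);
    rewrite /cube /= ?t01 ?s01 ?midpoint01 //.
  have xj := cell_midpoint js.
  by case=> [|[|[|k]]] //=; rewrite ?subrr ?normr0 //;
    [apply: lt_trans xi nd1|apply: lt_trans xj nd1].
rewrite RintegralZl in hJ; [|exact: measurable_itv|exact: intg01_slice].
rewrite mulrDr.
set J := \int[leb]_(s in I01) _ in hJ *.
set S := n%:R^-1 * \sum_j (Q _ _ * _) in hJ *.
have -> : D t * (D t * u i 0) + D t * J - (S + D (midpoint i) ^+ 2 * u i 0)
  = (D t ^+ 2 - D (midpoint i) ^+ 2) * u i 0 + (D t * J - S) by ring.
apply: le_trans (ler_normD _ _) _; rewrite mulrDr; apply: lerD.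
  by rewrite normrM ler_wpM2r.
by apply: le_trans hJ _; rewrite -mulr_sumr mulrCA.
Qed.

(** Nonnegativity of the variance of the [|x_i|], with [m] their mean. *)
Lemma sqr_mean_le n (x : 'I_n -> R) :
  n%:R^-1 * (\sum_i `|x i|) ^+ 2 <= \sum_i x i ^+ 2.
Proof.
case: n x => [|n] x; first by rewrite !big_ord0 invr0 mul0r.
set s := \sum_i `|x i|; pose m := n.+1%:R^-1 * s.
have n0 : n.+1%:R != 0 :> R by rewrite pnatr_eq0.
have : 0 <= \sum_i (`|x i| - m) ^+ 2 by apply: sumr_ge0 => i _; exact: sqr_ge0.
have -> : \sum_i (`|x i| - m) ^+ 2 = \sum_i x i ^+ 2 - 2 * m * s + n.+1%:R * m ^+ 2.
  rewrite /s mulr_sumr -sumrB.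
  have -> : n.+1%:R * m ^+ 2 = \sum_(i < n.+1) m ^+ 2.
    by rewrite sumr_const card_ord mulr_natl.
  rewrite -big_split /=; apply: eq_bigr => i _.
  by rewrite -(@real_normK _ (x i)) ?num_real //; ring.
have -> : n.+1%:R * m ^+ 2 = m * s by rewrite /m; field.
have -> : n.+1%:R^-1 * s ^+ 2 = m * s by rewrite /m; ring.
by lra.
Qed.

Lemma qform_sum n (M : 'M[R]_n) (v : 'cV[R]_n) :
  qform M v = \sum_i v i 0 * (M *m v) i 0.
Proof. by rewrite /qform -mulmxA mxE; apply: eq_bigr => i _; rewrite mxE. Qed.

Lemma Mmx_coercive : exists2 c, 0 < c & \forall n \near \oo,
  forall v : 'cV[R]_n, c * \sum_i v i 0 ^+ 2 <= qform (Mmx D K n) v.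
Proof.
have [c c0 hc] := positive_operator_coercive hA hApos hAself hAinv.
exists (c / 2); first by rewrite divr_gt0.
(* The term in [|v_i|] and the term in the mean each cost at most a quarter of [c] times the sum of
   squares, so half of the coercivity survives. *)
have eta0 : 0 < c / 4 by rewrite divr_gt0.
move: (operator_step_approx eta0) (inv_lt_near (@ltr01 R)).
apply: filterS2 => n happ [n0 _] v.
pose g := stepL2 (v^~ 0).
have ni : 0 < n%:R :> R by rewrite ltr0n.
have nV : 0 < n%:R^-1 :> R by rewrite invr_gt0.
set m := n%:R^-1 * \sum_j `|v j 0| in happ.
have gE t i : cell i t -> g t = v i 0 by move=> it; exact: step_cell.
have h1 : ip g g = n%:R^-1 * \sum_i v i 0 ^+ 2.
  have := @Rintegral01_cells R n _ (fun i => v i 0 ^+ 2) (fun=> 0) n0 (intg01_mul g g).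
  rewrite [X in _ <= _ * X]big1 // mulr0 => h; apply/eqP; rewrite -subr_eq0 -normr_le0.
  by apply: h; apply: aeW => t i it; rewrite (gE t i it) -expr2 subrr normr0.
have h2 : `|ip g (A g) - n%:R^-1 * qform (Mmx D K n) v| <=
    n%:R^-1 * \sum_i `|v i 0| * (c / 4 * (`|v i 0| + m)).
  rewrite qform_sum; apply: Rintegral01_cells => //; first exact: intg01_mul.
  apply: filterS (happ v) => t ht i it.
  rewrite (gE t i it) -mulrBr normrM ler_wpM2l //.
  exact: ht.
have h3 : \sum_i `|v i 0| * (c / 4 * (`|v i 0| + m)) <= c / 2 * \sum_i v i 0 ^+ 2.
  have -> : \sum_i `|v i 0| * (c / 4 * (`|v i 0| + m)) =
     c / 4 * (\sum_i v i 0 ^+ 2 + n%:R^-1 * (\sum_i `|v i 0|) ^+ 2).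
    rewrite expr2 mulrA -/m mulr_sumr -big_split /= mulr_sumr; apply: eq_bigr => i _.
    by rewrite -(@real_normK _ (v i 0)) ?num_real //; ring.
  have := sqr_mean_le (fun i => v i 0).
  have c4 : 0 < c / 4 by [].
  by move=> h; have := ler_wpM2l (ltW c4) h; lra.
have h4 := hc g; rewrite h1 in h4.
have h5 := ler_wpM2l (ltW nV) h3.
rewrite -(ler_pM2l nV).
have h6 : ip g (A g) <= n%:R^-1 * qform (Mmx D K n) v +
    n%:R^-1 * \sum_i `|v i 0| * (c / 4 * (`|v i 0| + m)).
  by move: h2; rewrite ler_norml => /andP[_]; lra.
lra.
Qed.

Lemma Smx_diag n : Smx D n = diag_mx (\row_i D (midpoint i)).
Proof. by apply/matrixP => i j; rewrite !mxE; case: eqP => [->|_]; rewrite ?mulr1 ?mulr0. Qed.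

Lemma Mmx_decomposition n : Mmx D K n = Smx D n *m Rmx K n *m Smx D n.
Proof.
apply/matrixP => i j.
rewrite Smx_diag mul_mx_diag mul_diag_mx !mxE.
by case: eqP => [->|_] /=; ring.
Qed.

Definition kernel_mx n : 'M[R]_n :=
  \matrix_(i, j) (n%:R^-1 * K (midpoint i) (midpoint j)).

Lemma Rmx_add1 n : Rmx K n = 1%:M + kernel_mx n.
Proof. by apply/matrixP => i j; rewrite !mxE addrC. Qed.

Lemma D_midpoint n (i : 'I_n) : Dinf < D (midpoint i) < Dsup.
Proof. by apply: hD; exact: midpoint01. Qed.

Lemma D_midpoint_gt0 n (i : 'I_n) : 0 < D (midpoint i).
Proof. by have /andP[h _] := D_midpoint i; exact: lt_trans h. Qed.

Lemma Rmx_coercive : exists2 c, 0 < c & \forall n \near \oo,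
  forall w : 'cV[R]_n, c * \sum_i w i 0 ^+ 2 <= qform (1%:M + kernel_mx n) w.
Proof.
have [c c0 hc] := Mmx_coercive.
have Ds0 : 0 < Dsup.
  have z01 : 0 <= (0 : R) <= 1 by rewrite lexx ler01.
  by have /andP[h1 h2] := hD z01; rewrite (lt_trans hDinf) // (lt_trans h1).
(* With [w = S v] the form of [R] at [w] is the form of [M] at [v], and
   [|v|^2 >= |w|^2 / Dsup^2]. *)
exists (c / Dsup ^+ 2); first by rewrite divr_gt0 // exprn_gt0.
apply: filterS hc => n hc w.
pose v : 'cV[R]_n := \col_i (w i 0 / D (midpoint i)).
have Sv : Smx D n *m v = w.
  apply/colP => i; rewrite Smx_diag mul_diag_mx !mxE mulrC divfK //.
  by rewrite gt_eqF // D_midpoint_gt0.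
have -> : qform (1%:M + kernel_mx n) w = qform (Mmx D K n) v.
  rewrite -Rmx_add1 /qform Mmx_decomposition -Sv trmx_mul.
  by rewrite {1}Smx_diag tr_diag_mx -Smx_diag !mulmxA.
apply: le_trans (hc v); rewrite -mulrA ler_pM2l // mulr_sumr; apply: ler_sum => i _.
rewrite mxE expr_div_n mulrC ler_wpM2l ?sqr_ge0 //.
have /andP[d1 d2] := D_midpoint i; have d0 := D_midpoint_gt0 i.
by rewrite lef_pV2 ?posrE ?exprn_gt0 // lerXn2r ?nnegrE ?ltW.
Qed.

Lemma kernel_mx_sym n : (kernel_mx n)^T = kernel_mx n.
Proof. by apply/matrixP => i j; rewrite !mxE hKsym ?midpoint01. Qed.

Lemma kernel_bounded : exists2 M, 0 < M &
  forall s t, 0 <= s <= 1 -> 0 <= t <= 1 -> `|K s t| <= M.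
Proof.
have [M M0 hM] := compact_continuous_bounded
   (compact_setX (@segment_compact R 0 1) (@segment_compact R 0 1)) hKcont.
by exists M => // s t s01 t01; apply: (hM (s, t)); split; rewrite /= in_itv.
Qed.

Lemma resolvent_bound : exists2 Q, 0 < Q & \forall n \near \oo,
  [/\ (0 < n)%N, 0 < \det (Rmx K n), Rmx K n \in unitmx,
      forall i j, `|(invmx (Rmx K n) - 1%:M) i j| <= Q / n%:R &
      1 <= \det (Rmx K n) ^+ 2 * expR (2 * Q + Q ^+ 2)].
Proof.
have [c c0 hc] := Rmx_coercive; have [M M0 hM] := kernel_bounded.
exists (M + M ^+ 2 / c); first by rewrite addr_gt0 // divr_gt0 // exprn_gt0.
set Q := _ + _; have Q0 : 0 < Q by rewrite addr_gt0 // divr_gt0 // exprn_gt0.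
move: hc (inv_lt_near (@ltr01 R)); apply: filterS2 => n hc [n0 _].
have Hle i j : `|kernel_mx n i j| <= M / n%:R.
  by rewrite mxE normrM ger0_norm // mulrC ler_wpM2r // hM // midpoint01.
have Hs := kernel_mx_sym n.
rewrite Rmx_add1; split => //.
- by case/andP: (posdef_det (posdef_add1 c0 Hs hc)).
- exact: (add1_unitmx c0 Hs hc).
- exact: (resolvent_entry_le c0 Hs Hle hc).
- apply: le_trans (det_add1_lower c0 Hs Hle hc) _; rewrite -/Q.
  apply: ler_wpM2l; first exact: sqr_ge0.
  set x := 2 * Q + Q ^+ 2; have x0 : 0 <= x by rewrite addr_ge0 ?sqr_ge0 // mulr_ge0 // ltW.
  (* [(1 + x / n)^n <= e^x] removes the dependence on [n], so that the bound survives the limit. *)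
  have -> : expR x = expR (x / n%:R) ^+ n.
    by rewrite -expRM_natl mulrC divfK // pnatr_eq0 -lt0n.
  by rewrite lerXn2r ?nnegrE ?expR_ge0 ?expR_ge1Dx // addr_ge0 // divr_ge0.
Qed.

(** * The Fredholm determinant and the log-determinants as limits *)

Definition minor_kernel k (xs : seq R) := \det (\matrix_(p < k, q < k) K xs`_p xs`_q).

Lemma midpoint_sum0 n k : @midpoint_sum R n k (fun=> 0) = 0.
Proof. by elim: k => //= k ->; rewrite big1 ?mulr0. Qed.

Lemma det_Rmx_expansion n N : (n < N)%N -> \det (Rmx K n) =
  series (fun k => (k`!%:R)^-1 * midpoint_sum n k (minor_kernel k)) N.
Proof.
move=> nN; rewrite Rmx_add1 (det_add1_minors _ nN) /series /=.
apply: eq_bigr => k _; congr (_ * _).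
rewrite midpoint_sum_tuples mulr_sumr; apply: eq_bigr => t _.
rewrite /minor_kernel -detZ; congr determinant; apply/matrixP => p q; rewrite !mxE.
by rewrite !(nth_map (tnth t p)) ?size_tuple // -!tnth_nth.
Qed.

Lemma fredholm_cvg : cvgn (series (fredholm_term K)) /\
  \det (Rmx K n) @[n --> \oo] --> fredholm_det K.
Proof.
have [M M0 hM] := kernel_bounded.
apply: (@dominated_series_cvg _
   (fun n k => (k`!%:R)^-1 * midpoint_sum n k (minor_kernel k)) _ (hadamard_bound M)).
- move=> k; rewrite /fredholm_term; apply: cvgM; first exact: cvg_cst.
  apply: midpoint_sum_cvg; rewrite /minor_kernel.
  have [] // := @bounded_unif_cont_det R k k (fun p q xs => K xs`_p xs`_q) _.
  by move=> p q; exact: bounded_unif_cont2.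
- move=> n k; rewrite normrM ger0_norm ?invr_ge0 // mulrC /hadamard_bound ler_wpM2r ?invr_ge0 //.
  (* Comparison with the midpoint sum of the zero function bounds the sum by a bound for its
     integrand. *)
  rewrite -[X in `|X|]subr0 -(midpoint_sum0 n k).
  apply: midpoint_sum_le; first exact: sqrtr_ge0.
  move=> xs cx; rewrite subr0 -sqrtr_sqr ler_sqrt; last first.
    by rewrite exprn_ge0 // mulr_ge0 // sqr_ge0.
  apply: det_le_entries => p q; rewrite mxE.
  by apply: hM; exact: (cube_nth cx).
- exact: cvg_hadamard_bound.
- move=> n; exists n.+1 => // N nN; exact: det_Rmx_expansion.
Qed.

(** Positivity of [det R_n] passes to the limit as [>=]; the lower bound on its square, uniform in
    [n], excludes [0]. *)
Lemma fredholm_det_gt0 : 0 < fredholm_det K.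
Proof.
have [_ cR] := fredholm_cvg; have [Q Q0 hQ] := resolvent_bound.
have d0 : 0 <= fredholm_det K.
  by apply: (cvg_lower_bound cR); apply: filterS hQ => n [_ /ltW].
have h : 1 <= fredholm_det K ^+ 2 * expR (2 * Q + Q ^+ 2).
  have cR2 : \det (Rmx K n) ^+ 2 * expR (2 * Q + Q ^+ 2) @[n --> \oo] -->
      fredholm_det K ^+ 2 * expR (2 * Q + Q ^+ 2).
    by apply: cvgM; [apply: cvgM|exact: cvg_cst].
  by apply: (cvg_lower_bound cR2); apply: filterS hQ => n [].
rewrite lt_neqAle d0 andbT; apply/eqP => e.
by move: h; rewrite -e expr0n mul0r ler10.
Qed.

Lemma det_Smx n : \det (Smx D n) = \prod_(i < n) D (midpoint i).
Proof. by rewrite Smx_diag det_diag; apply: eq_bigr => i _; rewrite mxE. Qed.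

Lemma det_Smx_gt0 n : 0 < \det (Smx D n).
Proof. by rewrite det_Smx; apply: prodr_gt0 => i _; exact: D_midpoint_gt0. Qed.

Lemma det_Mmx n : \det (Mmx D K n) = \det (Smx D n) ^+ 2 * \det (Rmx K n).
Proof. by rewrite Mmx_decomposition !det_mulmx; ring. Qed.

Lemma log_det_Smx_cvg : n%:R^-1 * ln (\det (Smx D n)) @[n --> \oo] --> int_log D.
Proof.
pose g t := ln (D t).
have cg : {within `[0 : R, 1], continuous g}.
  apply/subspace_continuousP => x xI.
  have /subspace_continuousP/(_ x xI) cD := hDcont.
  apply: continuous_cvg cD; apply: continuous_ln.
  have x01 : 0 <= x <= 1 by move: xI; rewrite /= in_itv.
  by have /andP[h _] := hD x01; exact: lt_trans h.
have ug := continuous_unif_cont01 cg.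
have lnS n : ln (\det (Smx D n)) = \sum_(i < n) g (midpoint i).
  rewrite det_Smx /g.
  (* The induction carries positivity of the partial products, which additivity of [ln] requires. *)
  suff [] : 0 < \prod_(i < n) D (midpoint i) /\
    ln (\prod_(i < n) D (midpoint i)) = \sum_(i < n) ln (D (midpoint i)) by [].
  elim/big_ind2 : _ => [|x1 x2 y1 y2 [h1 h2] [h3 h4]|i _].
  - by rewrite ltr01 ln1.
  - by rewrite mulr_gt0 // lnM ?posrE // h2 h4.
  - by rewrite D_midpoint_gt0.
apply/cvgrPdist_le => e e0; have [d d0 hd] := ug e e0.
move: (inv_lt_near d0); apply: filterS => n [n0 nd].
by rewrite lnS; apply: Rintegral01_midpoints hd => //; exact: intg01_unif_cont.
Qed.

(** * The quadratic form and the log-likelihood *)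

(** Solve through the factors [S], [R], [S]: each [S^-1] costs [1 / Dinf] in the sup norm, and
    [R^-1] costs [1 + Q], since a row of [R^-1 - 1] has [n] entries of size at most [Q / n]. *)
Lemma Mmx_solution_bound C : 0 <= C -> exists2 U, 0 < U & \forall n \near \oo,
  forall y : 'cV[R]_n, (forall i, `|y i 0| <= C) ->
    Mmx D K n *m (invmx (Mmx D K n) *m y) = y /\
    forall i, `|(invmx (Mmx D K n) *m y) i 0| <= U.
Proof.
move=> C0; have [Q Q0 hQ] := resolvent_bound.
pose Z := C / Dinf; have Z0 : 0 <= Z by rewrite divr_ge0 // ltW.
(* The summand [1] keeps the bound positive when [C = 0]. *)
exists ((1 + Q) * Z / Dinf + 1).
  by rewrite ltr_wpDl // divr_ge0 ?(ltW hDinf) // mulr_ge0 // addr_ge0 // ltW.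
apply: filterS hQ => n [n0 d0 uR hR _] y hy.
have uM : Mmx D K n \in unitmx.
  rewrite unitmxE unitfE det_Mmx mulf_neq0 ?expf_neq0 // gt_eqF //; exact: det_Smx_gt0.
set u := invmx _ *m y.
have Mu : Mmx D K n *m u = y by rewrite mulmxA mulmxV // mul1mx.
split=> // i.
have invD (j : 'I_n) : 0 < (D (midpoint j))^-1 <= Dinf^-1.
  have /andP[d1 d2] := D_midpoint j; have dj := D_midpoint_gt0 j.
  by rewrite invr_gt0 dj lef_pV2 ?posrE // ltW.
pose w := Smx D n *m u.
have wE j : w j 0 = D (midpoint j) * u j 0 by rewrite /w Smx_diag mul_diag_mx !mxE.
pose z := Rmx K n *m w.
have zE j : z j 0 = y j 0 / D (midpoint j).
  have : y j 0 = D (midpoint j) * z j 0.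
    by rewrite -Mu Mmx_decomposition -!mulmxA -/w -/z Smx_diag mul_diag_mx !mxE.
  by move=> ->; rewrite mulrC mulKf // gt_eqF // D_midpoint_gt0.
have zZ j : `|z j 0| <= Z.
  have /andP[v0 v1] := invD j.
  by rewrite zE normrM (gtr0_norm v0) ler_pM // ltW.
have wR : w = z + (invmx (Rmx K n) - 1%:M) *m z.
  by rewrite mulmxBl mul1mx addrC subrK mulmxA mulVmx // mul1mx.
have wB : `|w i 0| <= (1 + Q) * Z.
  rewrite wR mxE mulrDl mul1r; apply: le_trans (ler_normD _ _) _; apply: lerD => //.
  rewrite mxE; apply: le_trans (ler_norm_sum _ _ _) _.
  have -> : Q * Z = \sum_(j < n) Q / n%:R * Z.
    rewrite sumr_const card_ord -mulr_natr; field.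
    by rewrite pnatr_eq0 -lt0n.
  by apply: ler_sum => j _; rewrite normrM ler_pM.
have -> : u i 0 = w i 0 * (D (midpoint i))^-1.
  by rewrite wE mulrC mulKf // gt_eqF // D_midpoint_gt0.
have /andP[v0 v1] := invD i.
rewrite normrM (gtr0_norm v0); apply: ler_wpDr => //.
by apply: ler_pM => //; exact: ltW.
Qed.

Lemma quad_inv_cvg (y : forall n : nat, 'cV[R]_n) (f : nat -> L2 R) :
  (exists C : R, forall (n : nat) (i : 'I_n), `|y n i 0| <= C) ->
  (forall n : nat, embeds (y n) (f n)) ->
  (n%:R^-1 * quad_inv (Mmx D K n) (y n) - ip (f n) (B (f n)))
     @[n --> \oo] --> (0 : R).
Proof.
move=> [C' hC'] hf.
pose C := Num.max C' 0; have C0 : 0 <= C by rewrite le_max lexx orbT.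
have hy n i : `|y n i 0| <= C by rewrite le_max hC'.
have [boundB _ AB] := hAinv.
have [CB CB0 hCB] := bounded_operator_ip boundB.
have [U U0 hU] := Mmx_solution_bound C0.
have fE n i t : cell i t -> f n t = y n i 0.
  by move=> it; apply: hf; move: it; rewrite /cell /= in_itv.
(* The error [eta (|u_i| + mean |u|)] is at most [2 U eta]; integrating it against
   [|B f| <= 1 + (B f)^2] gives the factor [1 + CB^2 C^2]. Hence [eta = e / L]. *)
pose L := 2 * U * (1 + CB ^+ 2 * C ^+ 2).
have L0 : 0 < L by rewrite !mulr_gt0 // ltr_wpDr // mulr_ge0 // sqr_ge0.
apply/cvgrPdist_le => e e0.
have eta0 : 0 < e / L by rewrite divr_gt0.
move: hU (operator_step_approx eta0) (inv_lt_near (@ltr01 R)).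
apply: filterS3 => n hU happ [n0 _].
have [Mu uU] := hU (y n) (hy n).
set u := invmx (Mmx D K n) *m y n in Mu uU.
pose g := stepL2 (u^~ 0).
have ipfg : ip (f n) g = n%:R^-1 * quad_inv (Mmx D K n) (y n).
  have := @Rintegral01_cells R n _ (fun i => y n i 0 * u i 0) (fun=> 0) n0 (intg01_mul (f n) g).
  rewrite [X in _ <= _ * X]big1 // mulr0 => h.
  have -> : quad_inv (Mmx D K n) (y n) = \sum_i y n i 0 * u i 0.
    by rewrite /quad_inv -mulmxA mxE; apply: eq_bigr => i _; rewrite mxE.
  apply/eqP; rewrite -subr_eq0 -normr_le0; apply: h; apply: aeW => t i it.
  have gt : g t = u i 0 by exact: step_cell.
  by rewrite (fE n i t it) gt subrr normr0.
have ipff : ip (f n) (f n) <= C ^+ 2.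
  have := @Rintegral01_cells_le R n _ (fun=> C ^+ 2) n0 (intg01_mul (f n) (f n)).
  rewrite sumr_const card_ord -[C ^+ 2 *+ n]mulr_natl mulKf ?pnatr_eq0 -?lt0n //.
  apply; apply: aeW => t i it.
  by rewrite (fE n i t it) -expr2 -real_normK ?num_real // lerXn2r ?nnegrE.
(* Self-adjointness: [<B f, A g> = <A B f, g> = <f, g>]. *)
have e1 : ip (f n) g = ip (B (f n)) (A g).
  by rewrite -hAself ipC -(ip_ae _ (AB (f n))) ipC.
pose h := B (f n).
have close : {ae leb, forall t, I01 t -> `|A g t - f n t| <= e / L * (2 * U)}.
  move: (cells_cover (R := R) n0) (happ u); apply: filterS2 => t ht hc tI.
  have [i it] := ht tI; rewrite (fE n i t it).
  have := hc i it; rewrite Mu => /le_trans; apply.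
  rewrite ler_pM2l // mulrDl mul1r; apply: lerD => //.
  rewrite mulrC ler_pdivrMr ?ltr0n // mulr_natr.
  rewrite -[X in _ *+ X](card_ord n) -sumr_const; exact: ler_sum.
have ih1 : intg01 (fun t => h t * A g t) by exact: intg01_mul.
have ih2 : intg01 (fun t => h t * f n t) by exact: intg01_mul.
have i1 : intg01 (fun=> 1 : R).
  by apply: (@intg01_bounded _ _ 1) => [|t _]; [exact: measurable_cst | rewrite normr1].
have iq : intg01 (fun t => e / L * (2 * U) * (1 + h t * h t)).
  by apply: intg01Z; apply: intg01D => //; exact: intg01_mul.
have diff : ip h (A g) - ip h (f n) = \int[leb]_(t in I01) (h t * A g t - h t * f n t).
  by rewrite RintegralB //; exact: measurable_itv.
have qE : \int[leb]_(t in I01) (e / L * (2 * U) * (1 + h t * h t)) =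
    e / L * (2 * U) * (1 + ip h h).
  rewrite RintegralZl; [|exact: measurable_itv|apply: intg01D => //; exact: intg01_mul].
  rewrite RintegralD; [|exact: measurable_itv|exact: i1|exact: intg01_mul].
  congr (_ * (_ + _)); rewrite Rintegral_cst /=; last exact: measurable_itv.
  by rewrite lebesgue_measure_itv /= lte_fin ltr01 sube0 mul1r.
(* [|h| <= 1 + h^2] replaces the Cauchy-Schwarz inequality and keeps the majorant integrable. *)
have pw t : I01 t -> `|A g t - f n t| <= e / L * (2 * U) ->
    `|h t * A g t - h t * f n t| <= e / L * (2 * U) * (1 + h t * h t).
  move=> tI ht; rewrite -mulrBr normrM mulrC ler_pM //.
  rewrite -expr2 -[h t ^+ 2]real_normK ?num_real //.
  have := sqr_ge0 (`|h t| - 1); have := normr_ge0 (h t); nra.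
have up : ip h (A g) - ip h (f n) <= e / L * (2 * U) * (1 + ip h h).
  rewrite diff -qE; apply: Rintegral01_ae_le => //; first exact: intg01B.
  by apply: filterS close => t ht tI; apply: le_trans (ler_norm _) (pw t tI (ht tI)).
have lo : - (ip h (A g) - ip h (f n)) <= e / L * (2 * U) * (1 + ip h h).
  rewrite diff -qE -mulN1r -RintegralZl; [|exact: measurable_itv|exact: intg01B].
  apply: Rintegral01_ae_le => //; first by apply: intg01Z; exact: intg01B.
  apply: filterS close => t ht tI; rewrite mulN1r.
  by apply: le_trans (ler_norm _) _; rewrite normrN; exact: (pw t tI (ht tI)).
have hh : ip h h <= CB ^+ 2 * C ^+ 2.
  by apply: le_trans (hCB (f n)) _; rewrite ler_wpM2l ?sqr_ge0.
have fin : e / L * (2 * U) * (1 + ip h h) <= e.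
  have eE : e / L * (2 * U) * (1 + CB ^+ 2 * C ^+ 2) = e.
    by rewrite -mulrA -/L divfK // gt_eqF.
  rewrite -[leRHS]eE; apply: ler_wpM2l; last by rewrite lerD2l.
  by apply/ltW/mulr_gt0 => //; exact: mulr_gt0.
rewrite sub0r normrN -ipfg e1 [ip (f n) _]ipC -/h ler_norml.
by apply/andP; split; lra.
Qed.

Lemma log_det_Rmx_cvg : ln (\det (Rmx K n)) @[n --> \oo] --> ln (fredholm_det K).
Proof.
have [_ cR] := fredholm_cvg.
by apply: continuous_cvg cR; apply: continuous_ln; exact: fredholm_det_gt0.
Qed.

Lemma loglik_cvg (y : forall n : nat, 'cV[R]_n) (f : nat -> L2 R) :
  (exists C : R, forall (n : nat) (i : 'I_n), `|y n i 0| <= C) ->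
  (forall n : nat, embeds (y n) (f n)) ->
  (n%:R^-1 * (quad_inv (Mmx D K n) (y n) + ln (\det (Mmx D K n)))
     - loglik n D K B (f n)) @[n --> \oo] --> (0 : R).
Proof.
move=> hy hf.
have cq := quad_inv_cvg hy hf; have cS := log_det_Smx_cvg.
have cln := log_det_Rmx_cvg.
have cinv : n%:R^-1 @[n --> \oo] --> (0 : R).
  apply/cvgrPdist_le => e e0; move: (inv_lt_near e0); apply: filterS => n [n0 ne].
  by rewrite sub0r normrN ger0_norm // ltW.
have [Q _ hQ] := resolvent_bound.
(* The identity is available for large [n], where [det R_n > 0] lets the logarithm of
   [det M_n = det S_n ^ 2 * det R_n] split. *)
have e : \forall n \near \oo,
   (n%:R^-1 * quad_inv (Mmx D K n) (y n) - ip (f n) (B (f n)))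
   + 2 * (n%:R^-1 * ln (\det (Smx D n)) - int_log D)
   + n%:R^-1 * (ln (\det (Rmx K n)) - ln (fredholm_det K)) =
   n%:R^-1 * (quad_inv (Mmx D K n) (y n) + ln (\det (Mmx D K n)))
     - loglik n D K B (f n).
  apply: filterS hQ => n [_ dR _ _ _].
  have dS := det_Smx_gt0 n.
  rewrite det_Mmx expr2 !lnM ?posrE ?mulr_gt0 // /loglik; ring.
apply: cvg_trans (near_eq_cvg e) _.
suff : (n%:R^-1 * quad_inv (Mmx D K n) (y n) - ip (f n) (B (f n)))
    + 2 * (n%:R^-1 * ln (\det (Smx D n)) - int_log D)
    + n%:R^-1 * (ln (\det (Rmx K n)) - ln (fredholm_det K)) @[n --> \oo] -->
    0 + 2 * (int_log D - int_log D) + 0 * (ln (fredholm_det K) - ln (fredholm_det K)).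
  by rewrite !subrr mulr0 mul0r !addr0.
apply: cvgD; [apply: cvgD => //|].
  by apply: cvgM; [exact: cvg_cst|apply: cvgB => //; exact: cvg_cst].
by apply: cvgM => //; apply: cvgB => //; exact: cvg_cst.
Qed.

Lemma det_pos_near : \forall n \near \oo,
  [/\ 0 < \det (Mmx D K n), 0 < \det (Rmx K n) & 0 < \det (Smx D n)].
Proof.
have [Q _] := resolvent_bound; apply: filterS => n [_ dR _ _ _].
by have dS := det_Smx_gt0 n; split => //; rewrite det_Mmx mulr_gt0 // exprn_gt0.
Qed.

End discretization.

(* A and Ainv stand for O and its inverse (the name O is the zero of nat). *)
Theorem theorem19 (R : realType)
  (A Ainv : L2 R -> L2 R) (D : R -> R) (Dinf Dsup : R) (K : R -> R -> R)
  (hA : bounded_operator A)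
  (hApos : positive_definite A)
  (hAself : self_adjoint A)
  (hAinv : inverse_operator A Ainv)
  (hAdec : decomposes A D K)
  (hDcont : {within `[0, 1], continuous D})
  (hDinf : 0 < Dinf)
  (hD : forall t : R, 0 <= t <= 1 -> Dinf < D t < Dsup)
  (hKcont : {within [set` `[0 : R, 1]] `*` [set` `[0 : R, 1]],
               continuous (fun z : R * R => K z.1 z.2)})
  (hKsym : forall s t : R, 0 <= s <= 1 -> 0 <= t <= 1 -> K s t = K t s)
  (hKpos : forall s t : R, 0 <= s <= 1 -> 0 <= t <= 1 -> 0 <= K s t)
  (y : forall n : nat, 'cV[R]_n)
  (hy : exists C : R, forall (n : nat) (i : 'I_n), `|y n i 0| <= C)
  (f : nat -> L2 R)
  (hf : forall n : nat, embeds (y n) (f n)) :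
  (* the Fredholm series converges and the logarithms and the inverse of the
     matrices make sense for large n *)
  [/\ cvgn (series (fredholm_term K)),
      0 < fredholm_det K &
      \forall n \near \oo, [/\ 0 < \det (Mmx D K n), 0 < \det (Rmx K n)
                             & 0 < \det (Smx D n)]]
  /\
  (n%:R^-1 * (quad_inv (Mmx D K n) (y n) + ln (\det (Mmx D K n)))
     - loglik n D K Ainv (f n)) @[n --> \oo] --> (0 : R)
  /\
  (n%:R^-1 * quad_inv (Mmx D K n) (y n) - ip (f n) (Ainv (f n)))
     @[n --> \oo] --> (0 : R)
  /\
  (forall n : nat, Mmx D K n = Smx D n *m Rmx K n *m Smx D n)
  /\
  ln (\det (Rmx K n)) @[n --> \oo] --> ln (fredholm_det K)
  /\
  n%:R^-1 * ln (\det (Smx D n)) @[n --> \oo] --> int_log D.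
Proof.
have hpos := fredholm_det_gt0 hA hApos hAself hAinv hAdec hDcont hDinf hD hKcont hKsym.
have [hcvg _] := fredholm_cvg hKcont.
split; first by split => //; exact: (det_pos_near hA hApos hAself hAinv hAdec hDcont hDinf hD).
split; first exact: (loglik_cvg hA hApos hAself hAinv hAdec hDcont hDinf hD).
split; first exact: (quad_inv_cvg hA hApos hAself hAinv hAdec hDcont hDinf hD).
split; first exact: Mmx_decomposition.
split; first exact: (log_det_Rmx_cvg hA hApos hAself hAinv hAdec hDcont hDinf hD).
exact: (log_det_Smx_cvg hDcont hDinf hD).
Qed.
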